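(* Let $L>0$, $T>0$, and let $F:\mathbb R\to\mathbb R$ be a $C^2$ function with $F(\sigma)>0$ for all $\sigma\in\mathbb R$; put $r=F(0)>0$. Let $\Pi(z)=\sqrt{z(2-z)}\,e^{-z/2}$ for $z\in[0,2]$ and $k_I^*=\frac{r}{2L}\Pi(2-\sqrt2)$. Let $k_I\in(0,k_I^* )$, let $\mu\in(0,(2-\sqrt2)/L]$ be such that $\frac{r}{2L}\Pi(\mu L)>k_I$, and let $q_1=2k_I$, $q_2=r k_I e^{-\mu L/2}$. Then there are positive real constants $q_3,q_4,\delta,\beta$ such that, for each function $$(\phi,\xi)\in C([0,T];C^3[0,L]\times\mathbb R)\cap C^1([0,T];C^2[0,L]\times\mathbb R)$$ satisfying the closed-loop system (N), (N1), (N2) given in the context, and the condition $\|(\phi,\phi_x,\xi)\|_{T,\infty}<\delta$, the functional $$S(\phi,\xi)=\int_0^L\Big[\phi^2(x)e^{-\mu x}+q_1\xi\phi(x)e^{-\mu x/2}\Big]dx+q_2\xi^2+q_3\int_0^Le^{-\mu x}\phi_x^2(x)\,dx+q_4\int_0^Le^{-\mu x}\phi_{xx}^2(x)\,dx$$ satisfies $$\frac{d}{dt}S(\phi(\cdot,t),\xi(t))\le-\beta\,S(\phi(\cdot,t),\xi(t))\qquad\forall\,t\in[0,T].$$ Moreover there exists a constant $K\ge1$ such that $$K^{-1}\|(\phi,\xi)\|_X^2\le S(\phi,\xi)\le K\|(\phi,\xi)\|_X^2\qquad\forall\,(\phi,\xi)\in X.$$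
   Context: $X=H^2(0,L)\times\mathbb R$ with norm $\|(f,z)\|_X^2=\int_0^L(|f|^2+|f'|^2+|f''|^2)dx+z^2$. For $(\phi,\xi)\in C([0,T];C^1[0,L]\times\mathbb R)$, $$\|(\phi,\phi_x,\xi)\|_{T,\infty}=\sup_{t\in[0,T]}|\xi(t)|+\sup_{x\in[0,L],\,t\in[0,T]}|\phi(x,t)|+\sup_{x\in[0,L],\,t\in[0,T]}|\phi_x(x,t)|.$$ The closed-loop system consists of the following relations, for $x\in[0,L]$, $t\in[0,T]$, where $s=\phi_x$ and $p=\phi_{xx}$: (N) $\phi_t+F(\phi)\phi_x=0$, $\ \dot\xi(t)=\phi(L,t)$, $\ \phi(0,t)=-k_I\xi(t)$ (with initial data $\phi(\cdot,0)=\phi_0$, $\xi(0)=\xi_0$); (N1) $s_t+F(\phi)s_x=-F'(\phi)s^2$, $\ F(\phi(0,t))\,s(0,t)=k_I\phi(L,t)$ (with $s(\cdot,0)=\phi_0'$); (N2) $p_t+F(\phi)p_x=-3F'(\phi)\,s\,p-F''(\phi)\,s^3$, $\ F^2(\phi(0,t))\,p(0,t)=k_IF(\phi(L,t))\,s(L,t)-2k_IF'(\phi(0,t))\,\phi(L,t)\,s(0,t)$ (with $p(\cdot,0)=\phi_0''$). The relations (N1) and (N2) are obtained from (N) by successive differentiation. *)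

(* Defs.v *)
From HB Require Import structures.
From mathcomp Require Import all_boot all_order all_algebra.
From mathcomp Require Import all_classical all_reals all_analysis.

Set Implicit Arguments.
Unset Strict Implicit.
Unset Printing Implicit Defensive.

Import Order.TTheory GRing.Theory Num.Theory.
Import numFieldNormedType.Exports.

Local Open Scope classical_set_scope.
Local Open Scope ring_scope.

(* A function phi(x,t) is a curve [phi : R -> R -> R] with [phi t x] = phi(x,t);
   only its values on [0,T] x [0,L] matter. *)

(* Derivatives on a closed interval: the difference quotient is restricted to
   [a,b], hence one-sided at the endpoints. *)

Definition diff_quot (R : realType) (f : R -> R) (x y : R) : R :=
  (f y - f x) / (y - x).

Definition derivable_in (R : realType) (a b : R) (f : R -> R) (x : R) : Prop :=
  cvg (diff_quot f x y @[y --> within `[a, b] x^']).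

Definition derive_in (R : realType) (a b : R) (f : R -> R) (x : R) : R :=
  lim (diff_quot f x y @[y --> within `[a, b] x^']).

Definition deriven_in (R : realType) (a b : R) (n : nat) (f : R -> R) : R -> R :=
  iter n (derive_in a b) f.

Definition Ck_in (R : realType) (a b : R) (k : nat) (f : R -> R) : Prop :=
  (forall i, (i < k)%N -> forall x : R, x \in `[a, b] ->
     derivable_in a b (deriven_in a b i f) x) /\
  (forall i, (i <= k)%N -> {within `[a, b], continuous (deriven_in a b i f)}).

Definition sup_norm (R : realType) (a b : R) (f : R -> R) : R :=
  sup [set `|f x| | x in `[a, b]].

Definition Ck_norm (R : realType) (a b : R) (k : nat) (f : R -> R) : R :=
  \sum_(i < k.+1) sup_norm a b (deriven_in a b i f).

Definition C0T_Ck (R : realType) (T L : R) (k : nat) (u : R -> R -> R) : Prop :=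
  (forall t : R, t \in `[0, T] -> Ck_in 0 L k (u t)) /\
  (forall t0 : R, t0 \in `[0, T] ->
     Ck_norm 0 L k (u t \- u t0) @[t --> within `[0, T] (nbhs t0)] --> (0 : R)).

(* [v] is the time derivative of [u] in the Banach space C^k[0,L]. *)
Definition C1T_Ck (R : realType) (T L : R) (k : nat) (u : R -> R -> R) : Prop :=
  C0T_Ck T L k u /\
  exists v : R -> R -> R, C0T_Ck T L k v /\
    forall t0 : R, t0 \in `[0, T] ->
      Ck_norm 0 L k (fun x => (u t x - u t0 x) / (t - t0) - v t0 x)
        @[t --> within `[0, T] t0^'] --> (0 : R).

Definition C2_fun (R : realType) (F : R -> R) : Prop :=
  [/\ forall x, derivable F x 1, forall x, derivable (derive1 F) x 1
    & continuous (derive1n 2 F)].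

Definition dx (R : realType) (L : R) (phi : R -> R -> R) : R -> R -> R :=
  fun t => derive_in 0 L (phi t).

Definition dt (R : realType) (T : R) (phi : R -> R -> R) : R -> R -> R :=
  fun t x => derive_in 0 T (phi ^~ x) t.

Definition Tinf_norm (R : realType) (T L : R) (phi : R -> R -> R) (xi : R -> R)
    : R :=
  sup [set `|xi t| | t in `[0, T]]
  + sup [set `|phi tx.1 tx.2| | tx in `[0, T] `*` `[0, L]]
  + sup [set `|dx L phi tx.1 tx.2| | tx in `[0, T] `*` `[0, L]].

Section ClosedLoop.
Context (R : realType) (T L : R) (F : R -> R) (kI : R).
Context (phi0 : R -> R) (xi0 : R) (phi : R -> R -> R) (xi : R -> R).

Let s := dx L phi.
Let p := dx L s.

Definition sysN : Prop :=
  [/\ forall t x : R, t \in `[0, T] -> x \in `[0, L] ->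
        dt T phi t x + F (phi t x) * dx L phi t x = 0,
      forall t : R, t \in `[0, T] -> derive_in 0 T xi t = phi t L,
      forall t : R, t \in `[0, T] -> phi t 0 = - kI * xi t,
      forall x : R, x \in `[0, L] -> phi 0 x = phi0 x
    & xi 0 = xi0].

Definition sysN1 : Prop :=
  [/\ forall t x : R, t \in `[0, T] -> x \in `[0, L] ->
        dt T s t x + F (phi t x) * dx L s t x
        = - derive1 F (phi t x) * s t x ^+ 2,
      forall t : R, t \in `[0, T] -> F (phi t 0) * s t 0 = kI * phi t L
    & forall x : R, x \in `[0, L] -> s 0 x = derive_in 0 L phi0 x].

Definition sysN2 : Prop :=
  [/\ forall t x : R, t \in `[0, T] -> x \in `[0, L] ->
        dt T p t x + F (phi t x) * dx L p t x
        = - 3 * derive1 F (phi t x) * s t x * p t x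
          - derive1n 2 F (phi t x) * s t x ^+ 3,
      forall t : R, t \in `[0, T] ->
        F (phi t 0) ^+ 2 * p t 0
        = kI * F (phi t L) * s t L
          - 2 * kI * derive1 F (phi t 0) * phi t L * s t 0
    & forall x : R, x \in `[0, L] -> p 0 x = deriven_in 0 L 2 phi0 x].

Definition closed_loop : Prop := [/\ sysN, sysN1 & sysN2].

End ClosedLoop.

(* The Sobolev space H^2(0,L): L^2 functions whose first and second
   distributional derivatives are in L^2. *)

Definition L2_fun (R : realType) (a b : R) (f : R -> R) : Prop :=
  (f \_ `]a, b[) \in Lfun (@lebesgue_measure R) 2%:E.

Definition test_fun (R : realType) (a b : R) (psi : R -> R) : Prop :=
  (forall n x, derivable (derive1n n psi) x 1) /\
  (exists c d, [/\ a < c, d < b & forall x, psi x != 0 -> c <= x <= d]).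

Definition weak_derivative (R : realType) (a b : R) (f g : R -> R) : Prop :=
  forall psi, test_fun a b psi ->
    \int[@lebesgue_measure R]_(x in `]a, b[) (f x * derive1 psi x)
    = - \int[@lebesgue_measure R]_(x in `]a, b[) (g x * psi x).

(* [f] is in H^2(0,L), with f' = [f1] and f'' = [f2]. *)
Definition H2 (R : realType) (L : R) (f f1 f2 : R -> R) : Prop :=
  [/\ L2_fun 0 L f, L2_fun 0 L f1, L2_fun 0 L f2,
      weak_derivative 0 L f f1 & weak_derivative 0 L f1 f2].

Definition X_norm_sq (R : realType) (L : R) (f f1 f2 : R -> R) (z : R) : R :=
  \int[@lebesgue_measure R]_(x in `[0, L])
    (`|f x| ^+ 2 + `|f1 x| ^+ 2 + `|f2 x| ^+ 2) + z ^+ 2.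

(* S(f,z) for f with derivatives f' = [f1], f'' = [f2] (classical or weak). *)
Definition S_fun (R : realType) (L mu q1 q2 q3 q4 : R)
    (f f1 f2 : R -> R) (z : R) : R :=
  \int[@lebesgue_measure R]_(x in `[0, L])
    (f x ^+ 2 * expR (- mu * x) + q1 * z * f x * expR (- mu * x / 2))
  + q2 * z ^+ 2
  + q3 * \int[@lebesgue_measure R]_(x in `[0, L]) (expR (- mu * x) * f1 x ^+ 2)
  + q4 * \int[@lebesgue_measure R]_(x in `[0, L]) (expR (- mu * x) * f2 x ^+ 2).

Definition Pi_fun (R : realType) (z : R) : R :=
  Num.sqrt (z * (2 - z)) * expR (- z / 2).

Definition kI_star (R : realType) (L r : R) : R :=
  r / (2 * L) * Pi_fun (2 - Num.sqrt 2).

(* Main.v *)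
Require Import Defs.
From mathcomp Require Import all_boot all_order all_algebra.
From mathcomp Require Import all_classical all_reals all_analysis.
From mathcomp Require Import measurable_realfun ring lra.
Import Order.TTheory GRing.Theory Num.Theory.
Import numFieldNormedType.Exports.
Local Open Scope classical_set_scope.
Local Open Scope ring_scope.
Set Implicit Arguments.
Unset Strict Implicit.
Unset Printing Implicit Defensive.

(* Write w = e^(- mu x). Adding to the time derivative of the integrand of S the
   x-derivative of
     w F(phi) phi^2 + q1 xi w^(1/2) F(phi) phi
       + q3 w F(phi) phi_x^2 + q4 w F(phi) phi_xx^2
   removes all the terms in which phi, phi_x or phi_xx is multiplied by its own
   x-derivative; the integral of the added term is a boundary term. Once it is
   divided by L and moved under the integral sign, the decay estimate becomes
   an inequality between polynomials at each x, so that the Cauchy-Schwarz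
   inequality is never needed. For F = r and q3 = q4 = 0 it is the negativity
   of a quadratic form in (w^(1/2) phi(x), phi(L), xi), which the bound on k_I
   gives with a factor 2 to spare; this margin absorbs the inflow boundary
   terms of phi_x, then of phi_xx, by choosing q3, then q4, small, and finally
   the perturbations of size delta.

   S is differentiated along a solution by treating t |-> phi(., t) as a
   differentiable curve for the sup norm of (phi, phi_x, phi_xx), so that no
   exchange of mixed derivatives is involved. *)

(** * The pointwise dissipation inequality *)

Lemma mul_le_sqr (R : realFieldType) (x y : R) : 2 * (x * y) <= x ^+ 2 + y ^+ 2.
Proof. rewrite -subr_ge0; have := sqr_ge0 (x - y); lra. Qed.

Lemma young (R : realFieldType) (P u x a : R) : 0 < P ->
  2 * u * x * a <= P * x ^+ 2 + u ^+ 2 / P * a ^+ 2.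
Proof.
move=> P0; rewrite -subr_ge0.
have -> : P * x ^+ 2 + u ^+ 2 / P * a ^+ 2 - 2 * u * x * a =
  P * (x - u / P * a) ^+ 2 by field; lra.
by rewrite mulr_ge0 ?sqr_ge0// ltW.
Qed.

(** Both cross terms contain a. Young's inequality with the weights 2P/3 and 2Z/3 costs 3/2 (u^2/P +
    v^2/Z) <= 3A/4 on a^2, so A/4, P/3 and Z/3 are left; c is the least of these. *)
Lemma coercive3 (R : realFieldType) (A P Z u v : R) : 0 < A -> 0 < P -> 0 < Z ->
  u ^+ 2 / P + v ^+ 2 / Z <= A / 2 ->
  exists c, 0 < c /\ forall a x y : R,
    c * (a ^+ 2 + x ^+ 2 + y ^+ 2) <=
    A * a ^+ 2 - 2 * u * x * a - 2 * v * y * a + P * x ^+ 2 + Z * y ^+ 2.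
Proof.
move=> A0 P0 Z0 h.
pose c := Num.min (A / 4) (Num.min (P / 3) (Z / 3)).
have cA : c <= A / 4 by rewrite /c ge_min lexx.
have cP : c <= P / 3 by rewrite /c !ge_min lexx !orbT.
have cZ : c <= Z / 3 by rewrite /c !ge_min lexx !orbT.
have c0 : 0 < c by rewrite /c !lt_min; apply/and3P; split; lra.
exists c; split=> // a x y.
have PP : 0 < P * (2 / 3) by lra.
have ZZ : 0 < Z * (2 / 3) by lra.
have := young u x a PP; have := young v y a ZZ.
have -> : u ^+ 2 / (P * (2 / 3)) = 3 / 2 * (u ^+ 2 / P) by field; lra.
have -> : v ^+ 2 / (Z * (2 / 3)) = 3 / 2 * (v ^+ 2 / Z) by field; lra.
move=> h1 h2.
have := ler_wpM2r (sqr_ge0 a) h; have := ler_wpM2r (sqr_ge0 a) cA.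
have := ler_wpM2r (sqr_ge0 x) cP; have := ler_wpM2r (sqr_ge0 y) cZ.
lra.
Qed.

Lemma norm_mul_le (R : realFieldType) (h e x B : R) :
  `|h| <= e -> `|x| <= B -> h * x <= e * B.
Proof.
move=> he xB; apply: le_trans (ler_norm _) _; rewrite normrM.
by apply: ler_pM => //; exact: normr_ge0.
Qed.

Lemma norm_prod_le (R : realFieldType) (x y : R) :
  `|2 * (x * y)| <= x ^+ 2 + y ^+ 2.
Proof.
rewrite ler_norml mul_le_sqr andbT.
have := mul_le_sqr (- x) y; rewrite sqrrN; lra.
Qed.

Section dissipation.
Context (R : realFieldType) (L r k mu lam : R).

(** In [coercive3] take A = mu r, P = lam^2 r / L, Z = r k^2 / L, u = k and v = - k mu r / 2. Then
    v^2/Z = mu r (mu L) / 4 and the gain condition gives u^2/P < mu r (2 - mu L) / 4, so the sum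
    stays below A/2, whereas definiteness alone would allow anything below A. *)
Lemma linear_dissipation :
  0 < L -> 0 < r -> 0 < k -> 0 < mu -> 0 < lam ->
  k ^+ 2 < (r / (2 * L)) ^+ 2 * (mu * L * (2 - mu * L)) * lam ^+ 2 ->
  exists c, 0 < c /\ forall a y xi : R,
  - mu * r * a ^+ 2 + 2 * k * y * a - k * mu * r * xi * a
  - lam ^+ 2 * r / L * y ^+ 2 - r * k ^+ 2 / L * xi ^+ 2
  <= - c * (a ^+ 2 + y ^+ 2 + xi ^+ 2).
Proof.
move=> L0 r0 k0 mu0 lam0 hk.
have lam2 : 0 < lam ^+ 2 by rewrite exprn_gt0.
have k2 : 0 < k ^+ 2 by rewrite exprn_gt0.
have [||||c [c0 H]] := @coercive3 R (mu * r) (lam ^+ 2 * r / L) (r * k ^+ 2 / L)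
  k (- (k * mu * r / 2)).
- by rewrite mulr_gt0.
- by rewrite divr_gt0 ?mulr_gt0.
- by rewrite divr_gt0 ?mulr_gt0.
- have -> : (- (k * mu * r / 2)) ^+ 2 / (r * k ^+ 2 / L) = mu * r * (mu * L) / 4.
    by field; rewrite ?gt_eqF.
  have : k ^+ 2 / (lam ^+ 2 * r / L) <= mu * r * (2 - mu * L) / 4.
    rewrite ler_pdivrMr ?divr_gt0 ?mulr_gt0//; apply: (le_trans (ltW hk)).
    by rewrite le_eqVlt; apply/orP; left; apply/eqP; field; rewrite ?gt_eqF.
  lra.
- exists c; split=> // a y xi.
  rewrite mulNr -subr_ge0.
  by have := H a y xi; rewrite -subr_ge0; congr (_ <= _); field; rewrite gt_eqF.
Qed.

(** The inflow condition turns the flux of phi_x^2 entering at x = 0 into a multiple of phi(L)^2, a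
    quantity that the linear form dissipates. *)
Lemma boundary_slope_bound (F0 s0 y : R) :
  0 < r -> r / 2 <= F0 -> F0 * s0 = k * y -> F0 * s0 ^+ 2 <= 2 * k ^+ 2 / r * y ^+ 2.
Proof.
move=> r0 hF0 e; have F00 : 0 < F0 by lra.
have -> : F0 * s0 ^+ 2 = k ^+ 2 * y ^+ 2 / F0.
  by rewrite -exprMn -e exprMn expr2; field; rewrite gt_eqF.
have -> : 2 * k ^+ 2 / r * y ^+ 2 = k ^+ 2 * y ^+ 2 / (r / 2).
  by field; rewrite gt_eqF.
apply: ler_wpM2l; first by rewrite mulr_ge0 ?sqr_ge0.
by rewrite lef_pV2 ?posrE//; lra.
Qed.

(** Multiply by F0^3 >= r^3/8, insert the inflow condition and use (X - Y)^2 <= 2 X^2 + 2 Y^2. The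
    entering flux of phi_xx^2 is then paid by phi_x(L)^2, which the outflow of the q3 term provides,
    and by phi(L)^2. *)
Lemma boundary_curvature_bound (F0 FL d y s0 sL p0 : R) :
  0 < r -> r / 2 <= F0 -> 0 <= FL <= 3 / 2 * r -> `|d * s0| <= r / 2 ->
  F0 ^+ 2 * p0 = k * FL * sL - 2 * k * d * y * s0 ->
  F0 * p0 ^+ 2 <= 36 * k ^+ 2 / r * sL ^+ 2 + 16 * k ^+ 2 / r * y ^+ 2.
Proof.
move=> r0 hF0 /andP[FL0 hFL] hd e; have F00 : 0 < F0 by lra.
have F03 : r ^+ 3 / 8 <= F0 ^+ 3.
  have -> : r ^+ 3 / 8 = (r / 2) ^+ 3 by field.
  by rewrite lerXn2r ?nnegrE//; lra.
have FL2 : FL ^+ 2 <= 9 / 4 * r ^+ 2.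
  have -> : 9 / 4 * r ^+ 2 = (3 / 2 * r) ^+ 2 by field.
  by rewrite lerXn2r ?nnegrE//; lra.
have d2 : (d * s0) ^+ 2 <= r ^+ 2 / 4.
  rewrite -real_normK ?num_real//.
  have -> : r ^+ 2 / 4 = (r / 2) ^+ 2 by field.
  by rewrite lerXn2r ?nnegrE//; lra.
have r3 : 0 < r ^+ 3 / 8 by rewrite divr_gt0 ?exprn_gt0.
rewrite -(ler_pM2l r3).
apply: (@le_trans _ _ (F0 ^+ 3 * (F0 * p0 ^+ 2))).
  by rewrite ler_wpM2r// mulr_ge0 ?sqr_ge0// ltW.
have -> : F0 ^+ 3 * (F0 * p0 ^+ 2) = (F0 ^+ 2 * p0) ^+ 2 by ring.
rewrite e.
have -> : r ^+ 3 / 8 * (36 * k ^+ 2 / r * sL ^+ 2 + 16 * k ^+ 2 / r * y ^+ 2) =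
  2 * k ^+ 2 * (9 / 4 * r ^+ 2 * sL ^+ 2) + 8 * k ^+ 2 * (r ^+ 2 / 4 * y ^+ 2).
  by field; rewrite gt_eqF.
have h1 := ler_wpM2r (sqr_ge0 sL) FL2; have h2 := ler_wpM2r (sqr_ge0 y) d2.
have k2 := sqr_ge0 k.
apply: (@le_trans _ _ (2 * k ^+ 2 * (FL ^+ 2 * sL ^+ 2) +
   8 * k ^+ 2 * ((d * s0) ^+ 2 * y ^+ 2))).
  have := sqr_ge0 (k * FL * sL + 2 * k * d * y * s0).
  rewrite -subr_ge0 => h; rewrite -subr_ge0; move: h; congr (_ <= _); ring.
by apply: lerD; (apply: ler_wpM2l; first by rewrite mulr_ge0).
Qed.

(* In the next three definitions [a], [b], [c] stand for phi, phi_x, phi_xx at x,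
   multiplied by e^(- mu x / 2), and [lam] is that weight at x = L.
   [lyap_density] is the integrand of S, with q2 xi^2 spread evenly over [0, L];
   [lyap_rate] is its time derivative along the system plus the x-derivative of
   [flux], with [y] = phi(L), [h1] = F'(phi) phi_x and [h2] = F''(phi) phi_x^2. *)
Definition lyap_density (q3 q4 a b c xi : R) : R :=
  a ^+ 2 + 2 * k * xi * a + r * k * lam / L * xi ^+ 2
  + q3 * b ^+ 2 + q4 * c ^+ 2.

Definition flux (q3 q4 Fx e u v w xi : R) : R :=
  e ^+ 2 * Fx * u ^+ 2 + 2 * k * xi * e * Fx * u
  + q3 * (e ^+ 2 * Fx * v ^+ 2) + q4 * (e ^+ 2 * Fx * w ^+ 2).

Definition lyap_rate (q3 q4 a b c xi y Fx h1 h2 : R) : R :=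
  - mu * Fx * a ^+ 2 + h1 * a ^+ 2 + 2 * k * y * a
  - k * mu * Fx * xi * a + 2 * k * h1 * xi * a + 2 * (r * k * lam / L) * xi * y
  + q3 * (- mu * Fx * b ^+ 2 - h1 * b ^+ 2)
  + q4 * (- mu * Fx * c ^+ 2 - 5 * h1 * c ^+ 2 - 2 * h2 * b * c).

(** This is the error made in the terms without q3 and q4 when F is frozen at r: dF, dL, d0 are the
    deviations of F(phi) from r at x, L and 0. Each monomial is at most a^2 + y^2 + xi^2, and the
    constant collects the coefficients. *)
Lemma perturbation_bound (eta a y xi dF dL d0 h1 : R) :
  0 < L -> 0 < k -> 0 < mu -> 0 < lam ->
  `|dF| <= eta -> `|dL| <= eta -> `|d0| <= eta -> `|h1| <= eta ->
  - mu * dF * a ^+ 2 + h1 * a ^+ 2 - k * mu * dF * xi * a + 2 * k * h1 * xi * a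
  - 2 * k * lam / L * dL * xi * y - lam ^+ 2 / L * dL * y ^+ 2
  - k ^+ 2 / L * d0 * xi ^+ 2 <=
  eta * (mu + 1 + k * mu + 2 * k + 2 * k * lam / L + lam ^+ 2 / L + k ^+ 2 / L)
    * (a ^+ 2 + y ^+ 2 + xi ^+ 2).
Proof.
move=> L0 k0 mu0 lam0 hF hL' h0 hh; set Q := a ^+ 2 + y ^+ 2 + xi ^+ 2.
have a2 := sqr_ge0 a; have y2 := sqr_ge0 y; have x2 := sqr_ge0 xi.
have nF : `|- dF| <= eta by rewrite normrN.
have nL : `|- dL| <= eta by rewrite normrN.
have n0 : `|- d0| <= eta by rewrite normrN.
have Qa : `|a ^+ 2| <= Q by rewrite ger0_norm// /Q; lra.
have Qy : `|y ^+ 2| <= Q by rewrite ger0_norm// /Q; lra.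
have Qx : `|xi ^+ 2| <= Q by rewrite ger0_norm// /Q; lra.
have Qxa : `|xi * a| <= Q.
  by have := norm_prod_le xi a; rewrite normrM ger0_norm// /Q; lra.
have Qxy : `|xi * y| <= Q.
  by have := norm_prod_le xi y; rewrite normrM ger0_norm// /Q; lra.
have c1 : 0 <= k * mu by rewrite mulr_ge0 ?ltW.
have c2 : 0 <= 2 * k by rewrite mulr_ge0 ?ltW.
have c3 : 0 <= 2 * k * lam / L by rewrite divr_ge0 ?mulr_ge0 ?ltW.
have c4 : 0 <= lam ^+ 2 / L by rewrite divr_ge0 ?sqr_ge0 ?ltW.
have c5 : 0 <= k ^+ 2 / L by rewrite divr_ge0 ?sqr_ge0 ?ltW.
have := ler_wpM2l (ltW mu0) (norm_mul_le nF Qa).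
have := norm_mul_le hh Qa.
have := ler_wpM2l c1 (norm_mul_le nF Qxa).
have := ler_wpM2l c2 (norm_mul_le hh Qxa).
have := ler_wpM2l c3 (norm_mul_le nL Qxy).
have := ler_wpM2l c4 (norm_mul_le nL Qy).
have := ler_wpM2l c5 (norm_mul_le n0 Qx).
move: (2 * k * lam / L) (lam ^+ 2 / L) (k ^+ 2 / L) => A B C.
clearbody Q; lra.
Qed.

Lemma lyap_density_le (c0 m q3 q4 beta a b c xi : R) :
  0 < L -> 0 < r -> 0 < k -> 0 < lam -> 0 <= q3 -> 0 <= q4 -> 0 <= beta ->
  beta * (1 + k + r * k * lam / L) <= c0 / 4 -> beta <= m / 4 ->
  beta * lyap_density q3 q4 a b c xi <=
    c0 / 4 * (a ^+ 2 + xi ^+ 2) + m / 4 * (q3 * b ^+ 2 + q4 * c ^+ 2).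
Proof.
move=> L0 r0 k0 lam0 q30 q40 beta0 b1 b2.
have A0 : 0 <= r * k * lam / L by rewrite divr_ge0 ?mulr_ge0 ?ltW.
have a2 := sqr_ge0 a; have x2 := sqr_ge0 xi.
have B1 := ler_wpM2l (ltW k0) (mul_le_sqr xi a).
have B2 := mulr_ge0 A0 a2.
have B : a ^+ 2 + 2 * k * xi * a + r * k * lam / L * xi ^+ 2 <=
    (1 + k + r * k * lam / L) * (a ^+ 2 + xi ^+ 2).
  by move: (r * k * lam / L) B2 => A B2; clear -B1 B2 x2; lra.
have B3 : beta * (q3 * b ^+ 2 + q4 * c ^+ 2) <= m / 4 * (q3 * b ^+ 2 + q4 * c ^+ 2).
  by rewrite ler_wpM2r// addr_ge0// mulr_ge0// sqr_ge0.
have := lerD (le_trans (ler_wpM2l beta0 B) _) B3.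
rewrite mulrA => /(_ (c0 / 4 * (a ^+ 2 + xi ^+ 2))); rewrite -mulrDr !addrA.
by apply; rewrite ler_wpM2r// addr_ge0.
Qed.

(** The product b c carries the weight q4; since q4 <= q3, its b^2 half can be charged to q3 b^2.
    The losses are then at most 2 eta on q3 b^2 and 6 eta on q4 c^2, and 6 eta <= m/4. *)
Lemma gradient_decay (eta m M q3 q4 b c h1 h2 : R) :
  0 <= q4 -> q4 <= q3 -> 0 <= eta -> eta <= m / 24 -> m / 2 <= M ->
  `|h1| <= eta -> `|h2| <= eta ->
  q3 * ((- M - h1) * b ^+ 2) + q4 * ((- M - 5 * h1) * c ^+ 2) - 2 * q4 * h2 * b * c
  <= - (m / 4 * (q3 * b ^+ 2 + q4 * c ^+ 2)).
Proof.
move=> q40 q43 eta0 e2 hM hh1 hh2.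
move: (hh1); rewrite ler_norml => /andP[h11 h12].
have b2 := sqr_ge0 b; have c2 := sqr_ge0 c; have q30 : 0 <= q3 by exact: le_trans q43.
have B1 : (- M - h1) * b ^+ 2 <= (- (m / 2) + eta) * b ^+ 2.
  by rewrite ler_wpM2r//; lra.
have B2 : (- M - 5 * h1) * c ^+ 2 <= (- (m / 2) + 5 * eta) * c ^+ 2.
  by rewrite ler_wpM2r//; lra.
have B3 : (- h2) * (2 * (b * c)) <= eta * (b ^+ 2 + c ^+ 2).
  by apply: norm_mul_le; rewrite ?normrN// norm_prod_le.
have C1 := ler_wpM2l q30 B1; have C2 := ler_wpM2l q40 B2.
have C3 := ler_wpM2l q40 B3.
have C4 := ler_wpM2r (mulr_ge0 eta0 b2) q43.
have C5 := ler_wpM2l (mulr_ge0 q30 b2) e2.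
have C6 := ler_wpM2l (mulr_ge0 q40 c2) e2.
have m0 : 0 <= m by lra.
have C7 := mulr_ge0 (mulr_ge0 q30 b2) m0.
have C8 := mulr_ge0 (mulr_ge0 q40 c2) m0.
clear -C1 C2 C3 C4 C5 C6 C7 C8; lra.
Qed.

(** The bookkeeping that closes [dissipation]: t1 is the linear form, t2 the perturbation, t7 the
    gradient part, t3 and t4 the inflow of phi_x and phi_xx, t5 and t6 their outflow, t8 is beta
    times the density, and t9 is a quarter of c0 y^2. *)
Lemma add_bounds (t1 t2 t3 t4 t5 t6 t7 t8 t9 u1 u2 u4 u5 u6 u7 : R) :
  t1 <= u1 -> t2 <= u2 -> t3 <= t9 -> t4 <= u5 + u4 -> u4 <= t9 -> u5 <= t5 ->
  0 <= t6 -> t7 <= - u7 -> t8 <= u6 + u7 -> u1 + u2 + t9 + t9 <= - u6 ->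
  t1 + t2 + t7 + t3 - t5 + t4 - t6 <= - t8.
Proof. lra. Qed.

Lemma dissipation :
  0 < L -> 0 < r -> 0 < k -> 0 < mu -> 0 < lam ->
  k ^+ 2 < (r / (2 * L)) ^+ 2 * (mu * L * (2 - mu * L)) * lam ^+ 2 ->
  exists q3 q4 eta beta : R,
  [/\ 0 < q3, 0 < q4, 0 < eta & 0 < beta] /\
  forall a b c xi y sL pL s0 p0 Fx FL F0 h1 h2 d,
    `|Fx - r| <= eta -> `|FL - r| <= eta -> `|F0 - r| <= eta ->
    `|h1| <= eta -> `|h2| <= eta -> `|d * s0| <= eta ->
    F0 * s0 = k * y -> F0 ^+ 2 * p0 = k * FL * sL - 2 * k * d * y * s0 ->
    lyap_rate q3 q4 a b c xi y Fx h1 h2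
    - (flux q3 q4 FL lam y sL pL xi - flux q3 q4 F0 1 (- k * xi) s0 p0 xi) / L
    <= - beta * lyap_density q3 q4 a b c xi.
Proof.
move=> L0 r0 k0 mu0 lam0 hk.
have [c0 [c0gt0 Hlin]] := linear_dissipation L0 r0 k0 mu0 lam0 hk.
pose C1 := mu + 1 + k * mu + 2 * k + 2 * k * lam / L + lam ^+ 2 / L + k ^+ 2 / L.
pose C2 := 1 + k + r * k * lam / L.
(* The terms governed by q3, by q4 and by eta consume a quarter of c0 each. *)
pose q3 := c0 * r * L / (8 * k ^+ 2).
(* The three bounds serve, in order, [gradient_decay], the absorption of the phi_x(L)^2 part of the
   phi_xx inflow by the phi_x outflow, and the bound of its phi(L)^2 part by c0/4. *)
pose q4 := Num.min q3 (Num.min (q3 * lam ^+ 2 * r ^+ 2 / (72 * k ^+ 2))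
                               (c0 * r * L / (64 * k ^+ 2))).
(* The bound r/2 keeps F(phi) between r/2 and 3r/2, the second is the one of [gradient_decay] with m
   = mu r, and the third controls the perturbation. The last quarter of c0 pays for beta. *)
pose eta := Num.min (r / 2) (Num.min (mu * r / 24) (c0 / (4 * C1))).
pose beta := Num.min (c0 / (4 * C2)) (mu * r / 4).
have k2 : 0 < k ^+ 2 by rewrite exprn_gt0.
have l2 : 0 < lam ^+ 2 by rewrite exprn_gt0.
have C10 : 0 < C1.
  by rewrite /C1 !addr_gt0// ?divr_gt0 ?mulr_gt0.
have C20 : 0 < C2 by rewrite /C2 !addr_gt0// ?divr_gt0 ?mulr_gt0.
have q30 : 0 < q3 by rewrite /q3 divr_gt0 ?mulr_gt0.
have q3c : q3 * (2 * k ^+ 2 / r) / L = c0 / 4.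
  by rewrite /q3; field; rewrite ?gt_eqF.
clearbody q3.
have q40 : 0 < q4.
  rewrite /q4 !lt_min; apply/and3P; split=> //.
    by rewrite divr_gt0 ?mulr_gt0 ?exprn_gt0.
  by rewrite divr_gt0 // !mulr_gt0.
have eta0 : 0 < eta.
  by rewrite /eta !lt_min; apply/and3P; split; rewrite divr_gt0// !mulr_gt0.
have beta0 : 0 < beta.
  by rewrite /beta lt_min; apply/andP; split; rewrite divr_gt0// !mulr_gt0.
have q43 : q4 <= q3 by rewrite /q4 ge_min lexx.
have q4b : q4 * (36 * k ^+ 2 / r) <= q3 * lam ^+ 2 * (r / 2).
  apply: (@le_trans _ _ (q3 * lam ^+ 2 * r ^+ 2 / (72 * k ^+ 2) * (36 * k ^+ 2 / r))).
    apply: ler_wpM2r; first by rewrite divr_ge0 ?mulr_ge0 ?ltW.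
    by rewrite /q4 !ge_min lexx !orbT.
  by rewrite le_eqVlt; apply/orP; left; apply/eqP; field; rewrite ?gt_eqF.
have q4c : q4 * (16 * k ^+ 2 / r) / L <= c0 / 4.
  apply: (@le_trans _ _ (c0 * r * L / (64 * k ^+ 2) * (16 * k ^+ 2 / r) / L)).
    apply: ler_wpM2r; first by rewrite invr_ge0 ltW.
    apply: ler_wpM2r; first by rewrite divr_ge0 ?mulr_ge0 ?ltW.
    by rewrite /q4 !ge_min lexx !orbT.
  by rewrite le_eqVlt; apply/orP; left; apply/eqP; field; rewrite ?gt_eqF.
have e1 : eta <= r / 2 by rewrite /eta !ge_min lexx.
have e2 : eta <= mu * r / 24 by rewrite /eta !ge_min lexx !orbT.
have e3 : eta * C1 <= c0 / 4.
  apply: (@le_trans _ _ (c0 / (4 * C1) * C1)).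
    by apply: ler_wpM2r; rewrite ?(ltW C10)// /eta !ge_min lexx !orbT.
  by rewrite le_eqVlt; apply/orP; left; apply/eqP; field; rewrite ?gt_eqF.
have b1 : beta * C2 <= c0 / 4.
  apply: (@le_trans _ _ (c0 / (4 * C2) * C2)).
    by apply: ler_wpM2r; rewrite ?(ltW C20)// /beta ge_min lexx.
  by rewrite le_eqVlt; apply/orP; left; apply/eqP; field; rewrite ?gt_eqF.
have b2 : beta <= mu * r / 4 by rewrite /beta ge_min lexx orbT.
exists q3, q4, eta, beta; split=> // a b c xi y sL pL s0 p0 Fx FL F0 h1 h2 d.
move=> hFx hFL hF0 hh1 hh2 hd es0 ep0.
have Hlin' := Hlin a y xi.
have Herr := perturbation_bound a y xi L0 k0 mu0 lam0 hFx hFL hF0 hh1.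
move: (hFx) (hFL) (hF0) (hh1); rewrite !ler_norml.
move=> /andP[Fx1 Fx2] /andP[FL1 FL2] /andP[F01 F02] /andP[h11 h12].
have F0r : r / 2 <= F0 by lra.
have FLr : r / 2 <= FL by lra.
have FL0 : 0 < FL by lra.
have Hs := boundary_slope_bound r0 F0r es0.
have Hp : F0 * p0 ^+ 2 <= 36 * k ^+ 2 / r * sL ^+ 2 + 16 * k ^+ 2 / r * y ^+ 2.
  apply: (boundary_curvature_bound r0 F0r _ _ ep0); first by apply/andP; split; lra.
  exact: le_trans hd _.
have li : 0 <= L^-1 by rewrite invr_ge0 ltW.
have Hs' := ler_wpM2l (ltW q30) (ler_wpM2r li Hs).
have Hp' := ler_wpM2l (ltW q40) (ler_wpM2r li Hp).
pose Q := a ^+ 2 + y ^+ 2 + xi ^+ 2.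
have Q0 : 0 <= Q by rewrite /Q !addr_ge0 ?sqr_ge0.
have Herr' : eta * C1 * Q <= c0 / 4 * Q by rewrite ler_wpM2r.
have E3 : q3 * (2 * k ^+ 2 / r * y ^+ 2 / L) = c0 / 4 * y ^+ 2.
  by rewrite -q3c; ring.
have E4 : q4 * (16 * k ^+ 2 / r * y ^+ 2 / L) <= c0 / 4 * y ^+ 2.
  have := ler_wpM2r (sqr_ge0 y) q4c; congr (_ <= _); ring.
have E5 : q4 * (36 * k ^+ 2 / r * sL ^+ 2 / L) <=
    q3 * (lam ^+ 2 / L * FL * sL ^+ 2).
  apply: (@le_trans _ _ (q3 * lam ^+ 2 * (r / 2) * (sL ^+ 2 / L))).
    have sLL : 0 <= sL ^+ 2 / L by rewrite divr_ge0 ?sqr_ge0 ?ltW.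
    by have := ler_wpM2r sLL q4b; congr (_ <= _); ring.
  have -> : q3 * (lam ^+ 2 / L * FL * sL ^+ 2) = q3 * lam ^+ 2 * FL * (sL ^+ 2 / L).
    by ring.
  by rewrite ler_wpM2r ?divr_ge0 ?sqr_ge0 ?(ltW L0)// ler_wpM2l// mulr_ge0 ?ltW.
have E6 : 0 <= q4 * (lam ^+ 2 / L * FL * pL ^+ 2).
  exact: mulr_ge0 (ltW q40) (mulr_ge0 (mulr_ge0 (mulr_ge0 (ltW l2) li) (ltW FL0))
    (sqr_ge0 pL)).
have E7 : q3 * ((- (mu * Fx) - h1) * b ^+ 2) + q4 * ((- (mu * Fx) - 5 * h1) * c ^+ 2)
   - 2 * q4 * h2 * b * c <= - (mu * r / 4 * (q3 * b ^+ 2 + q4 * c ^+ 2)).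
  apply: (@gradient_decay eta) => //; [exact: ltW | exact: ltW |].
  by have := ler_wpM2l (ltW mu0) (_ : r / 2 <= Fx); rewrite mulrA; apply; lra.
have E8 := lyap_density_le a b c xi L0 r0 k0 lam0 (ltW q30) (ltW q40) (ltW beta0) b1 b2.
(* Here the values of q1 and q2 matter: for F = r the product xi y in the rate cancels against the
   flux at L, and the inflow value - k xi makes the phi part of the flux at 0 equal to - k^2 F0
   xi^2, a dissipative sign. *)
have -> : lyap_rate q3 q4 a b c xi y Fx h1 h2
    - (flux q3 q4 FL lam y sL pL xi - flux q3 q4 F0 1 (- k * xi) s0 p0 xi) / L =
  (- mu * r * a ^+ 2 + 2 * k * y * a - k * mu * r * xi * a
   - lam ^+ 2 * r / L * y ^+ 2 - r * k ^+ 2 / L * xi ^+ 2) +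
  (- mu * (Fx - r) * a ^+ 2 + h1 * a ^+ 2 - k * mu * (Fx - r) * xi * a
   + 2 * k * h1 * xi * a
   - 2 * k * lam / L * (FL - r) * xi * y - lam ^+ 2 / L * (FL - r) * y ^+ 2
   - k ^+ 2 / L * (F0 - r) * xi ^+ 2) +
  (q3 * ((- (mu * Fx) - h1) * b ^+ 2) + q4 * ((- (mu * Fx) - 5 * h1) * c ^+ 2)
   - 2 * q4 * h2 * b * c)
  + q3 * (F0 * s0 ^+ 2 / L) - q3 * (lam ^+ 2 / L * FL * sL ^+ 2)
  + q4 * (F0 * p0 ^+ 2 / L) - q4 * (lam ^+ 2 / L * FL * pL ^+ 2).
  by rewrite /lyap_rate /flux; ring.
move: Herr; rewrite -/C1 -/Q => Herr; rewrite (mulNr beta).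
have QE : c0 * Q = c0 * a ^+ 2 + c0 * y ^+ 2 + c0 * xi ^+ 2 by rewrite /Q; ring.
move: Hp'; rewrite mulrDl mulrDr => Hp'.
move: Hlin'; rewrite -/Q => Hlin'.
have Hq : - c0 * Q + eta * C1 * Q + c0 / 4 * y ^+ 2 + c0 / 4 * y ^+ 2
   <= - (c0 / 4 * (a ^+ 2 + xi ^+ 2)).
  have y2 : 0 <= c0 * y ^+ 2 by rewrite mulr_ge0 ?sqr_ge0 ?ltW.
  have x2 : 0 <= c0 * xi ^+ 2 by rewrite mulr_ge0 ?sqr_ge0 ?ltW.
  have a2 : 0 <= c0 * a ^+ 2 by rewrite mulr_ge0 ?sqr_ge0 ?ltW.
  by clear -QE x2 y2 a2 Herr'; lra.
rewrite E3 in Hs'.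
exact: (add_bounds Hlin' Herr Hs' Hp' E4 E5 E6 E7 E8 Hq).
Qed.

End dissipation.

(** * Derivatives relative to a closed interval *)

(** Properness makes limits of difference quotients unique, also at the endpoints. A nearby point of
    [a, b] is found on the right of x when x < b, and on the left when x = b. *)
Lemma within_dnbhs_proper (R : realType) (a b x : R) :
  a < b -> x \in `[a, b] -> ProperFilter (within `[a, b] x^').
Proof.
rewrite in_itv /= => ab /andP[ax xb].
apply: Build_ProperFilter_ex => P /nbhs_ballP[e /= e0 Pe].
have [xb'|bx] := ltP x b.
  pose y := Num.min b (x + e / 2).
  have xy : x < y by rewrite /y lt_min xb'/=; lra.
  have ye : y <= x + e / 2 by rewrite /y ge_min lexx orbT.
  have yb : y <= b by rewrite /y ge_min lexx.
  exists y; apply: Pe; rewrite /ball/= ?gt_eqF// ?in_itv/=.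
    by rewrite ltr_norml; apply/andP; split; lra.
  by apply/andP; split; lra.
pose y := Num.max a (x - e / 2).
have yx : y < x by rewrite /y gt_max; apply/andP; split; lra.
have ye : x - e / 2 <= y by rewrite /y le_max lexx orbT.
have ay : a <= y by rewrite /y le_max lexx.
exists y; apply: Pe; rewrite /ball/= ?lt_eqF// ?in_itv/=.
  by rewrite ltr_norml; apply/andP; split; lra.
by apply/andP; split; lra.
Qed.

Definition has_deriv_in (R : realType) (a b : R) (f : R -> R) (x l : R) : Prop :=
  diff_quot f x y @[y --> within `[a, b] x^'] --> l.

Lemma derive_inE (R : realType) (a b x l : R) (f : R -> R) :
  a < b -> x \in `[a, b] -> has_deriv_in a b f x l -> derive_in a b f x = l.
Proof.
move=> ab xab h; have P := within_dnbhs_proper ab xab.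
exact: cvg_lim h.
Qed.

Lemma derivable_in_has_deriv (R : realType) (a b x : R) (f : R -> R) :
  derivable_in a b f x -> has_deriv_in a b f x (derive_in a b f x).
Proof. by []. Qed.

Lemma has_deriv_inP (R : realType) (a b x l : R) (f : R -> R) :
  has_deriv_in a b f x l <->
  forall e, 0 < e -> \forall y \near within `[a, b] x^', `|l - diff_quot f x y| <= e.
Proof.
by split => [/cvgrPdist_le h e e0|h]; [exact: h | apply/cvgrPdist_le].
Qed.

Lemma has_deriv_in_eq (R : realType) (a b x l : R) (f g : R -> R) :
  x \in `[a, b] -> {in `[a, b], f =1 g} ->
  has_deriv_in a b f x l -> has_deriv_in a b g x l.
Proof.
move=> xab fg /has_deriv_inP h; apply/has_deriv_inP => e e0.
have [d /= d0 hd] := (nbhs_ballP _ _).1 (h _ e0).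
apply/nbhs_ballP; exists d => //= y /hd {}hd yx yab.
by rewrite /diff_quot -!fg//; exact: hd.
Qed.

Lemma has_deriv_in_comb (R : realType) (a b x l m c d : R) (f g : R -> R) :
  has_deriv_in a b f x l -> has_deriv_in a b g x m ->
  has_deriv_in a b (fun y => c * f y + d * g y) x (c * l + d * m).
Proof.
move=> hf hg; rewrite /has_deriv_in.
have -> : diff_quot (fun y => c * f y + d * g y) x =
    fun y => c * diff_quot f x y + d * diff_quot g x y.
  by apply/funext => y; rewrite /diff_quot; ring.
by apply: cvgD; apply: cvgM => //; exact: cvg_cst.
Qed.

Lemma has_deriv_in_is_derive (R : realType) (a b x l : R) (f : R -> R) :
  x \in `]a, b[ -> has_deriv_in a b f x l -> is_derive x 1 f l.
Proof.
rewrite in_itv /= => /andP[ax xb] /has_deriv_inP hf.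
have H : (fun h => h^-1 *: ((f \o shift x) (h *: 1) - f x)) @ 0^' --> l.
  apply/cvgrPdist_le => e e0.
  have [d /= d0 hd] := (nbhs_ballP _ _).1 (hf _ e0).
  apply/nbhs_ballP; exists (Num.min d (Num.min (x - a) (b - x))) => /=.
    by rewrite !lt_min; apply/and3P; split; lra.
  move=> h; rewrite /ball/= sub0r normrN !lt_min => /and3P[hd1 h2 h3] h0.
  move: h2 h3; rewrite !ltr_norml => /andP[h2 h2'] /andP[h3 h3'].
  have := hd (h + x); rewrite /diff_quot addrK [_ / h]mulrC.
  rewrite [h *: 1]mulr1; apply => /=.
  - by rewrite /ball/= opprD addrCA subrr addr0 normrN.
  - by apply: contra h0 => /eqP e1; apply/eqP; lra.
  - by rewrite in_itv/=; apply/andP; split; lra.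
by split; [apply/cvg_ex; exists l | exact: cvg_lim H].
Qed.

Lemma within_continuous_bounded (R : realType) (a b : R) (f : R -> R) :
  a <= b -> {within `[a, b], continuous f} ->
  exists M, forall x, x \in `[a, b] -> `|f x| <= M.
Proof.
move=> ab cf.
have cg : {within `[a, b], continuous (fun x => `|f x|)}.
  by move=> x; apply: cvg_norm; exact: cf.
have [c _ Hc] := EVT_max ab cg.
by exists `|f c|.
Qed.

(** * Sup norms and C^k norms *)

Lemma sup_norm_image_ge0 (R : realType) I (A : set I) (f : I -> R) :
  0 <= sup [set `|f i| | i in A].
Proof.
set E := [set _ | _ in _].
(* For an empty or unbounded set, [sup] takes the default value 0. *)
have [[[y Ey] uE]|nE] := pselect (has_sup E); last by rewrite sup_out.
apply: le_trans (ub_le_sup uE Ey).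
by case: Ey => x _ <-; exact: normr_ge0.
Qed.

Lemma sup_norm_ge0 (R : realType) (a b : R) (f : R -> R) : 0 <= sup_norm a b f.
Proof. exact: sup_norm_image_ge0. Qed.

Lemma norm_le_sup_norm (R : realType) (a b x M : R) (f : R -> R) :
  (forall x, x \in `[a, b] -> `|f x| <= M) -> x \in `[a, b] ->
  `|f x| <= sup_norm a b f.
Proof.
move=> fM xab; apply: ub_le_sup; last by exists x.
by exists M => _ [y /= yab <-]; exact: fM.
Qed.

Lemma sup_norm_le_Ck_norm (R : realType) (a b : R) k i (f : R -> R) :
  (i <= k)%N -> sup_norm a b (deriven_in a b i f) <= Ck_norm a b k f.
Proof.
rewrite -ltnS => ik; rewrite /Ck_norm (bigD1 (Ordinal ik))//= lerDl.
by apply: sumr_ge0 => j _; exact: sup_norm_ge0.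
Qed.

(** Three terms cover both uses: the increment u(t) - u(t0), and the difference quotient in time
    minus its limit. By induction on the order, [deriven_in] is linear on C^k functions; continuity
    bounds the set whose [sup] is taken, so that this [sup] is a true upper bound. *)
Lemma norm_deriven_le_Ck_norm (R : realType) (a b c d e : R) k (f g h : R -> R) :
  a < b -> Ck_in a b k f -> Ck_in a b k g -> Ck_in a b k h ->
  forall i, (i <= k)%N -> forall x, x \in `[a, b] ->
  `|c * deriven_in a b i f x + d * deriven_in a b i g x + e * deriven_in a b i h x|
  <= Ck_norm a b k (fun y => c * f y + d * g y + e * h y).
Proof.
move=> ab Cf Cg Ch i ik.
have Cfg : forall j, (j <= k)%N -> forall x, x \in `[a, b] ->
  deriven_in a b j (fun y => c * f y + d * g y + e * h y) x =
  c * deriven_in a b j f x + d * deriven_in a b j g x + e * deriven_in a b j h x.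
  elim=> [//|j IH jk x xab].
  apply: derive_inE => //.
  have D := has_deriv_in_comb (c := 1) (d := e) (has_deriv_in_comb (c := c) (d := d)
    (derivable_in_has_deriv (Cf.1 j jk x xab)) (derivable_in_has_deriv (Cg.1 j jk x xab)))
    (derivable_in_has_deriv (Ch.1 j jk x xab)).
  rewrite mul1r in D; apply: has_deriv_in_eq xab _ D.
  by move=> y yab; rewrite mul1r; exact/esym/(IH (ltnW jk)).
move=> x xab; rewrite -Cfg//; apply: le_trans (sup_norm_le_Ck_norm _ _ _ ik).
have [Mf hf] := within_continuous_bounded (ltW ab) (Cf.2 i ik).
have [Mg hg] := within_continuous_bounded (ltW ab) (Cg.2 i ik).
have [Mh hh] := within_continuous_bounded (ltW ab) (Ch.2 i ik).
apply: (@norm_le_sup_norm _ _ _ _ (`|c| * Mf + `|d| * Mg + `|e| * Mh)) => // y yab.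
rewrite Cfg//; apply: le_trans (ler_normD _ _) _; apply: lerD.
  apply: le_trans (ler_normD _ _) _; apply: lerD; rewrite normrM ler_wpM2l//.
    exact: hf.
  exact: hg.
by rewrite normrM ler_wpM2l// hh.
Qed.

(** * Curves of functions *)

(** Near each t0 the derivatives of u(t) are within 1 of those of u(t0), which are bounded on
    [0, L]; compactness of [0, T] makes the bound uniform. *)
Lemma C0T_Ck_bounded (R : realType) (T L : R) k i (u : R -> R -> R) :
  0 < L -> C0T_Ck T L k u -> (i <= k)%N ->
  exists M, forall t x, t \in `[0, T] -> x \in `[0, L] ->
    `|deriven_in 0 L i (u t) x| <= M.
Proof.
move=> L0 [Cu cu] ik.
pose P M t := t \in `[0, T] -> forall x, x \in `[0, L] ->
  `|deriven_in 0 L i (u t) x| <= M.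
(* Compactness is used in its near-covering form, with the candidate bound M tending to infinity as
   the parameter. *)
have [M [_ /(_ (M + 1))]] : \forall M \near +oo, `[0, T]%classic `<=` P M; last first.
  rewrite ltrDl ltr01 => /(_ isT) h.
  by exists (M + 1) => t x tT; exact: h.
apply: (compact_near_coveringP _).1; first exact: segment_compact.
move=> t0 t0T.
have [M0 hM0] := within_continuous_bounded (ltW L0) ((Cu t0 t0T).2 i ik).
have /cvgrPdist_le/(_ 1 ltr01) cu0 := cu t0 t0T.
exists ([set t | t \in `[0, T] -> `|0 - Ck_norm 0 L k (u t \- u t0)| <= 1],
        [set M | M0 + 1 <= M]).
  by split; [exact: cu0 | exact/nbhs_pinfty_ge/num_real].
move=> [t M] /= [ht hM] tT x xL.
have := norm_deriven_le_Ck_norm 1 (-1) 0 L0 (Cu t tT)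
  (Cu t0 t0T) (Cu t0 t0T) ik xL.
have -> : (fun y => 1 * u t y + -1 * u t0 y + 0 * u t0 y) = u t \- u t0.
  by apply/funext => y /=; ring.
have := ht tT; rewrite sub0r normrN.
have := hM0 x xL; have := ler_norm (Ck_norm 0 L k (u t \- u t0)).
move: (deriven_in 0 L i (u t) x) (deriven_in 0 L i (u t0) x) => p q h1 h2 h3 h4.
have -> : p = (1 * p + -1 * q + 0 * q) + q by ring.
apply: le_trans (ler_normD _ _) _; lra.
Qed.

(** Differentiability at t0 of a curve in the Banach space C[0,L], one-sided at the ends of [0, T].
    Continuity in x supplies the bounds for products and the integrability. *)
Definition unif_deriv (R : realType) (T L : R) (h : R -> R -> R) (v : R -> R)
    (t0 : R) : Prop :=
  [/\ forall t, t \in `[0, T] -> {within `[0, L], continuous (h t)},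
      {within `[0, L], continuous v}
    & forall e, 0 < e -> \forall t \near within `[0, T] t0^',
        forall x, x \in `[0, L] -> `|(h t x - h t0 x) / (t - t0) - v x| <= e].

Lemma unif_deriv_cst (R : realType) (T L : R) (w : R -> R) t0 :
  {within `[0, L], continuous w} -> unif_deriv T L (fun=> w) (cst 0) t0.
Proof.
move=> cw; split=> [//||e e0]; first by move=> x; exact: cvg_cst.
by near=> t => x xL; rewrite subrr mul0r subr0 normr0 ltW.
Unshelve. all: by end_near. Qed.

Lemma unif_deriv_time (R : realType) (T L : R) (xi : R -> R) t0 l :
  has_deriv_in 0 T xi t0 l -> unif_deriv T L (fun t => cst (xi t)) (cst l) t0.
Proof.
move=> /has_deriv_inP hxi; split=> [t _||e e0]; try by move=> x; exact: cvg_cst.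
by apply: filterS (hxi e e0) => t ht x xL; rewrite distrC.
Qed.

Lemma unif_derivD (R : realType) (T L : R) h k v w (t0 : R) :
  unif_deriv T L h v t0 -> unif_deriv T L k w t0 ->
  unif_deriv T L (fun t x => h t x + k t x) (fun x => v x + w x) t0.
Proof.
move=> [ch cv dh] [ck cw dk]; split=> [t tT x|x|e e0].
- by apply: cvgD; [exact: ch | exact: ck].
- by apply: cvgD; [exact: cv | exact: cw].
have e2 : 0 < e / 2 by lra.
apply: filterS2 (dh _ e2) (dk _ e2) => t h1 h2 x xL.
have -> : (h t x + k t x - (h t0 x + k t0 x)) / (t - t0) - (v x + w x) =
  ((h t x - h t0 x) / (t - t0) - v x) + ((k t x - k t0 x) / (t - t0) - w x) by ring.
by apply: le_trans (ler_normD _ _) _; have := h1 x xL; have := h2 x xL; lra.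
Qed.

Lemma unif_derivM (R : realType) (T L : R) h k v w (t0 : R) :
  0 <= L -> t0 \in `[0, T] ->
  unif_deriv T L h v t0 -> unif_deriv T L k w t0 ->
  unif_deriv T L (fun t x => h t x * k t x) (fun x => v x * k t0 x + h t0 x * w x) t0.
Proof.
move=> L0 t0T [ch cv dh] [ck cw dk]; split=> [t tT x|x|e e0].
- by apply: cvgM; [exact: ch | exact: ck].
- by apply: cvgD; apply: cvgM; [exact: cv | exact: ck | exact: ch | exact: cw].
have [Mh hMh] := within_continuous_bounded L0 (ch _ t0T).
have [Mk hMk] := within_continuous_bounded L0 (ck _ t0T).
have [Mv hMv] := within_continuous_bounded L0 cv.
have [Mw hMw] := within_continuous_bounded L0 cw.
(* M bounds h and k at t0 and, through 1 + Mv and 1 + Mw, also the quotients qh and qk once these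
   are within 1 of v and w. The error splits as (qh - v) k + h (qk - w) + (t - t0) qh qk with h, k
   at t0; each term gets e/3, hence the tolerances e/(3M), e/(3M) and e/(3M^2). *)
pose M := `|Mh| + `|Mk| + `|Mv| + `|Mw| + 1.
have [M1 Mh1 Mk1 Mv1 Mw1] : [/\ 1 <= M, Mh <= M, Mk <= M, 1 + Mv <= M & 1 + Mw <= M].
  have := ler_norm Mh; have := ler_norm Mk; have := ler_norm Mv; have := ler_norm Mw.
  have := normr_ge0 Mh; have := normr_ge0 Mk; have := normr_ge0 Mv.
  have := normr_ge0 Mw; rewrite /M; clear.
  by move: `|Mh| `|Mk| `|Mv| `|Mw| => a b c d *; split; lra.
have M0 : 0 < M by exact: lt_le_trans ltr01 M1.
have eM : 0 < e / (3 * M) by rewrite divr_gt0// mulr_gt0.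
have eM2 : 0 < e / (3 * M ^+ 2) by rewrite divr_gt0// mulr_gt0// exprn_gt0.
have near_t : \forall t \near within `[0, T] t0^', `|t - t0| <= e / (3 * M ^+ 2).
  apply/nbhs_ballP; exists (e / (3 * M ^+ 2)) => //= t.
  by rewrite /ball/= distrC => /ltW.
near=> t.
have H1 : forall x, x \in `[0, L] -> `|(h t x - h t0 x) / (t - t0) - v x| <= e / (3 * M).
  by near: t; exact: dh.
have H2 : forall x, x \in `[0, L] -> `|(k t x - k t0 x) / (t - t0) - w x| <= e / (3 * M).
  by near: t; exact: dk.
have H3 : forall x, x \in `[0, L] -> `|(h t x - h t0 x) / (t - t0) - v x| <= 1.
  by near: t; exact: dh.
have H4 : forall x, x \in `[0, L] -> `|(k t x - k t0 x) / (t - t0) - w x| <= 1.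
  by near: t; exact: dk.
have h3 : `|t - t0| <= e / (3 * M ^+ 2) by near: t.
have tt0 : t - t0 != 0.
  by rewrite subr_eq0; near: t; apply/nbhs_ballP; exists 1 => /=.
move=> x xL; have h1 := H1 x xL; have h2 := H2 x xL.
have h1' := H3 x xL; have h2' := H4 x xL.
have bh := hMh x xL; have bk := hMk x xL; have bv := hMv x xL; have bw := hMw x xL.
set qh := (h t x - h t0 x) / (t - t0) in h1 h1' *.
set qk := (k t x - k t0 x) / (t - t0) in h2 h2' *.
have -> : (h t x * k t x - h t0 x * k t0 x) / (t - t0) - (v x * k t0 x + h t0 x * w x) =
  (qh - v x) * k t0 x + h t0 x * (qk - w x) + (t - t0) * (qh * qk).
  by rewrite /qh /qk; field.
clearbody qh qk.
have bqh : `|qh| <= M.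
  by rewrite -(subrK (v x) qh) (le_trans (ler_normD _ _))// (le_trans (lerD h1' bv)).
have bqk : `|qk| <= M.
  by rewrite -(subrK (w x) qk) (le_trans (ler_normD _ _))// (le_trans (lerD h2' bw)).
have bk' := le_trans bk Mk1; have bh' := le_trans bh Mh1.
have e1 : `|(qh - v x) * k t0 x| <= e / 3.
  rewrite normrM (_ : e / 3 = e / (3 * M) * M); last by field; rewrite ?gt_eqF.
  by apply: ler_pM.
have e2 : `|h t0 x * (qk - w x)| <= e / 3.
  rewrite normrM (_ : e / 3 = M * (e / (3 * M))); last by field; rewrite ?gt_eqF.
  by apply: ler_pM.
have e3 : `|(t - t0) * (qh * qk)| <= e / 3.
  rewrite !normrM (_ : e / 3 = e / (3 * M ^+ 2) * (M * M)); last by field; rewrite ?gt_eqF.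
  by rewrite ler_pM ?mulr_ge0 ?ler_pM.
apply: le_trans (ler_normD _ _) _.
have := ler_normD ((qh - v x) * k t0 x) (h t0 x * (qk - w x)).
by move: e1 e2 e3; clear; lra.
Unshelve. all: by end_near. Qed.

Lemma unif_deriv_pointwise (R : realType) (T L x : R) h v (t0 : R) :
  x \in `[0, L] -> unif_deriv T L h v t0 -> has_deriv_in 0 T (h ^~ x) t0 (v x).
Proof.
move=> xL [_ _ dh]; apply/has_deriv_inP => e e0.
by apply: filterS (dh e e0) => t ht; rewrite distrC; exact: ht.
Qed.

(** Taking the i-th x-derivative is a bounded linear map from C^k to C^0, so it commutes with the
    time derivative of a curve in C^k. *)
Lemma unif_deriv_deriven (R : realType) (T L : R) k (u v : R -> R -> R) t0 :
  0 < L -> t0 \in `[0, T] -> C0T_Ck T L k u -> C0T_Ck T L k v ->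
  Ck_norm 0 L k (fun x => (u t x - u t0 x) / (t - t0) - v t0 x)
    @[t --> within `[0, T] t0^'] --> (0 : R) ->
  forall i, (i <= k)%N ->
  unif_deriv T L (fun t => deriven_in 0 L i (u t)) (deriven_in 0 L i (v t0)) t0.
Proof.
move=> L0 t0T [Cu _] [Cv _] /cvgrPdist_le duv i ik; split=> [t tT||e e0].
- exact: (Cu t tT).2.
- exact: (Cv t0 t0T).2.
have [d /= d0 hd] := (nbhs_ballP _ _).1 (duv e e0).
apply/nbhs_ballP; exists d => //= t /hd {}hd tt0 tT x xL.
have := norm_deriven_le_Ck_norm (t - t0)^-1 (- (t - t0)^-1) (-1)
 
  L0 (Cu t tT) (Cu t0 t0T) (Cv t0 t0T) ik xL.
have -> : (fun y => (t - t0)^-1 * u t y + - (t - t0)^-1 * u t0 y + -1 * v t0 y) =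
    (fun x => (u t x - u t0 x) / (t - t0) - v t0 x).
  by apply/funext => y; ring.
have := hd tt0 tT; rewrite sub0r normrN => h1 h2.
have := le_trans h2 (le_trans (ler_norm _) h1); congr (`|_| <= _); ring.
Qed.

(** * Integrals and the functional S *)

Lemma within_continuous_integrable (R : realType) (a b : R) (f : R -> R) :
  {within `[a, b], continuous f} ->
  (@lebesgue_measure R).-integrable `[a, b] (EFin \o f).
Proof. by apply: continuous_compact_integrable; exact: segment_compact. Qed.

Lemma Rintegral_cst_itv (R : realType) (L c : R) : 0 < L ->
  \int[@lebesgue_measure R]_(x in `[0, L]) c = c * L.
Proof.
move=> L0; rewrite Rintegral_cst//; congr (_ * _).
by rewrite [X in fine X]lebesgue_measure_itv/= lte_fin L0 sube0.
Qed.

Lemma Rintegral_is_derive (R : realType) (L : R) (B f : R -> R) : 0 < L ->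
  {within `[0, L], continuous B} -> {within `[0, L], continuous f} ->
  (forall x, x \in `]0, L[ -> is_derive x 1 B (f x)) ->
  \int[@lebesgue_measure R]_(x in `[0, L]) f x = B L - B 0.
Proof.
move=> L0 cB cf dB; have [_ B0 BL] := (continuous_within_itvP _ L0).1 cB.
rewrite /Rintegral (continuous_FTC2 (F := B))//.
  by split=> // x xL; have [] := dB x xL.
by move=> x xL; rewrite derive1E; have [_ ->] := dB x xL.
Qed.

(** Integration over [0, L] is a functional of norm L for the sup norm, whence the tolerance e /
    L. *)
Lemma unif_deriv_integral (R : realType) (T L : R) h v (t0 : R) :
  0 < L -> t0 \in `[0, T] -> unif_deriv T L h v t0 ->
  has_deriv_in 0 T (fun t => \int[@lebesgue_measure R]_(x in `[0, L]) h t x) t0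
    (\int[@lebesgue_measure R]_(x in `[0, L]) v x).
Proof.
move=> L0 t0T [ch cv dh]; apply/has_deriv_inP => e e0.
have [d /= d0 hd] := (nbhs_ballP _ _).1 (dh _ (divr_gt0 e0 L0)).
apply/nbhs_ballP; exists d => //= t /hd {}hd tt0 tT.
have cq : {within `[0, L], continuous (fun x => (h t x - h t0 x) / (t - t0))}.
  by move=> x; apply: cvgM; [apply: cvgB; exact: ch | exact: cvg_cst].
have cd : {within `[0, L], continuous (fun x => (h t x - h t0 x) / (t - t0) - v x)}.
  by move=> x; apply: cvgB; [exact: cq | exact: cv].
have cdh : {within `[0, L], continuous (fun x => h t x - h t0 x)}.
  by move=> x; apply: cvgB; exact: ch.
rewrite distrC /diff_quot -RintegralB//; [|exact/within_continuous_integrable/ch..].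
rewrite -RintegralZr//; last exact: within_continuous_integrable.
rewrite -RintegralB//; [|exact: within_continuous_integrable..].
apply: (le_trans (le_normr_Rintegral _ _)) => //.
  exact: within_continuous_integrable.
have -> : e = \int[@lebesgue_measure R]_(x in `[0, L]) (e / L).
  by rewrite Rintegral_cst_itv// divfK// gt_eqF.
apply: le_Rintegral => //.
- by apply: within_continuous_integrable => x; apply: cvg_norm; exact: cd.
- by apply: within_continuous_integrable => x; exact: cvg_cst.
- by move=> x xL; exact: hd.
Qed.

(** * Square-integrable functions on [0, L] *)

Definition sq_integrable (R : realType) (L : R) (f : R -> R) : Prop :=
  measurable_fun `[0, L] f /\
  (@lebesgue_measure R).-integrable `[0, L] (EFin \o (fun x => f x ^+ 2)).

Lemma continuous_sq_integrable (R : realType) (L : R) (f : R -> R) :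
  {within `[0, L], continuous f} -> sq_integrable L f.
Proof.
move=> cf; split.
  by have /measurable_int/measurable_EFinP := within_continuous_integrable cf.
by apply: within_continuous_integrable => x; apply: cvgM; exact: cf.
Qed.

(** [L2_fun] lives on the open interval and S on the closed one. The endpoints are null sets, added
    one at a time to the integral of f^2. *)
Lemma L2_fun_sq_integrable (R : realType) (L : R) (f : R -> R) :
  L2_fun 0 L f -> sq_integrable L f.
Proof.
rewrite /L2_fun => hf.
have fE : {in `]0, L[%classic, f \_ `]0, L[ =1 f} by move=> x xL; rewrite patchT.
have mo : measurable_fun `]0, L[ f.
  move: (hf); rewrite inE => /andP[+ _]; rewrite inE /= => mf.
  by apply: eq_measurable_fun fE _; exact: measurable_funTS mf.
have mf : measurable_fun `[0, L] f by exact: measurable_fun_itv_cc mo.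
split=> //.
have /integrableP[_ io] : (@lebesgue_measure R).-integrable `]0, L[ (EFin \o (fun x => f x ^+ 2)).
  apply: eq_integrable (integrableS _ _ _ (Lfun2_integrable_sqr hf)) => //.
  by move=> x xL /=; rewrite fE.
apply/integrableP; split.
  by apply/measurable_EFinP; apply: measurable_funX.
rewrite -integral_itv_obnd_cbnd; last first.
  apply: measurableT_comp => //; apply/measurable_EFinP; apply: measurable_funX.
  exact: measurable_fun_itv_oc mo.
rewrite -integral_itv_bndo_bndc//; last first.
  by apply: measurableT_comp => //; apply/measurable_EFinP; exact: measurable_funX.
Qed.

Lemma sq_integrable_integrable (R : realType) (L : R) (f : R -> R) :
  sq_integrable L f -> (@lebesgue_measure R).-integrable `[0, L] (EFin \o f).
Proof.
move=> [mf sf].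
have one : (@lebesgue_measure R).-integrable `[0, L] (EFin \o cst 1).
  by apply: within_continuous_integrable => x; exact: cvg_cst.
apply: le_integrable (integrableD _ one sf) => //.
  exact/measurable_EFinP.
move=> x _ /=; rewrite lee_fin; have h := sqr_ge0 (f x).
rewrite [leRHS]ger0_norm; last by rewrite addr_ge0.
rewrite ler_norml; have := sqr_ge0 (f x - 1); have := sqr_ge0 (f x + 1).
by move=> h1 h2; apply/andP; split; lra.
Qed.

Lemma integrableM_continuous (R : realType) (L : R) (w f : R -> R) : 0 <= L ->
  {within `[0, L], continuous w} ->
  (@lebesgue_measure R).-integrable `[0, L] (EFin \o f) ->
  (@lebesgue_measure R).-integrable `[0, L] (EFin \o (fun x => w x * f x)).
Proof.
move=> L0 cw fi; have [M hM] := within_continuous_bounded L0 cw.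
have mw := measurable_int _ (within_continuous_integrable cw).
have mf := measurable_int _ fi.
apply: le_integrable (integrableZl _ M fi) => //.
  by apply/measurable_EFinP; apply: measurable_funM; exact/measurable_EFinP.
move=> x xL /=; rewrite lee_fin !normrM ler_wpM2r//.
by apply: le_trans (ler_norm _); exact: hM.
Qed.

(** * Comparison of S with the squared norm of X *)

Lemma lyap_density_coercive (R : realFieldType) (L r k lam q3 q4 : R) :
  0 < L -> 0 < r -> 0 < k -> 0 < lam -> 0 < q3 -> 0 < q4 -> 2 * k * L < r * lam ->
  exists m M, [/\ 0 < m, 0 < M & forall a b c z,
    m * (a ^+ 2 + b ^+ 2 + c ^+ 2 + z ^+ 2) <= lyap_density L r k lam q3 q4 a b c z
    <= M * (a ^+ 2 + b ^+ 2 + c ^+ 2 + z ^+ 2)].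
Proof.
move=> L0 r0 k0 lam0 q30 q40 hk.
pose A := r * k * lam / L.
have A0 : 0 < A by rewrite divr_gt0 ?mulr_gt0.
have Ak : 2 * k ^+ 2 < A.
  rewrite /A ltr_pdivlMr//; have := hk; rewrite -(ltr_pM2l k0).
  by congr (_ < _); ring.
(* From a^2 + 2 k z a + A z^2 = a^2 / 2 + (a + 2 k z)^2 / 2 + (A - 2 k^2) z^2. *)
pose m := Num.min (Num.min (1 / 2) (A - 2 * k ^+ 2)) (Num.min q3 q4).
have m1 : m <= 1 / 2 by rewrite /m !ge_min lexx.
have m2 : m <= A - 2 * k ^+ 2 by rewrite /m !ge_min lexx !orbT.
have m3 : m <= q3 by rewrite /m !ge_min lexx !orbT.
have m4 : m <= q4 by rewrite /m !ge_min lexx !orbT.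
have m0 : 0 < m.
  by rewrite /m !lt_min q30 q40 subr_gt0 Ak divr_gt0.
exists m, (1 + k + A + q3 + q4); split=> //; first by rewrite !addr_gt0.
move=> a b c z; rewrite /lyap_density -/A; clearbody A m.
have [a2 b2 c2 z2] : [/\ 0 <= a ^+ 2, 0 <= b ^+ 2, 0 <= c ^+ 2 & 0 <= z ^+ 2].
  by rewrite !sqr_ge0.
apply/andP; split.
  have := ler_wpM2r a2 m1; have := ler_wpM2r b2 m3; have := ler_wpM2r c2 m4.
  have := ler_wpM2r z2 m2; have := sqr_ge0 (a + 2 * k * z).
  by clear; lra.
have := ler_wpM2l (ltW k0) (mul_le_sqr z a).
have := mulr_ge0 (ltW q30) a2; have := mulr_ge0 (ltW q30) c2.
have := mulr_ge0 (ltW q30) z2; have := mulr_ge0 (ltW q40) a2.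
have := mulr_ge0 (ltW q40) b2; have := mulr_ge0 (ltW q40) z2.
have := mulr_ge0 (ltW A0) a2; have := mulr_ge0 (ltW A0) b2.
have := mulr_ge0 (ltW A0) c2; have := mulr_ge0 (ltW k0) b2.
have := mulr_ge0 (ltW k0) c2.
by move: a2 b2 c2 z2; clear; lra.
Qed.

Lemma expR_half_sqr (R : realType) (x : R) : expR (x / 2) ^+ 2 = expR x.
Proof. by rewrite expr2 -expRD; congr expR; field. Qed.

Lemma expR_continuous_within (R : realType) (A : set R) (c d : R) :
  {within A, continuous (fun x => expR (c * x / d))}.
Proof.
apply: continuous_subspaceT => x; apply: continuous_comp; last exact: continuous_expR.
by apply: cvgM; [apply: cvgM; [exact: cvg_cst | exact: cvg_id] | exact: cvg_cst].
Qed.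

Section S_fun_density.
Context (R : realType) (L mu r k lam q3 q4 : R) (f f1 f2 : R -> R) (z : R).

Let dens x := lyap_density L r k lam q3 q4 (expR (- mu * x / 2) * f x)
  (expR (- mu * x / 2) * f1 x) (expR (- mu * x / 2) * f2 x) z.
Let A x := f x ^+ 2 * expR (- mu * x) + 2 * k * z * f x * expR (- mu * x / 2).

(** Square integrability is common to the classical derivatives along a solution and to the weak
    derivatives in H^2, so both halves of the theorem reduce to pointwise estimates of
    [lyap_density]. *)
Lemma S_fun_density : 0 < L -> sq_integrable L f -> sq_integrable L f1 ->
  sq_integrable L f2 ->
  (@lebesgue_measure R).-integrable `[0, L] (EFin \o dens) /\
  S_fun L mu (2 * k) (r * k * lam) q3 q4 f f1 f2 z =
    \int[@lebesgue_measure R]_(x in `[0, L]) dens x.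
Proof.
move=> L0 sf sf1 sf2; have L0' := ltW L0.
have cw : {within `[0, L], continuous (fun x => expR (- mu * x))}.
  have -> : (fun x => expR (- mu * x)) = fun x => expR (- mu * x / 1).
    by apply/funext => x; rewrite divr1.
  exact: expR_continuous_within.
have cwf : {within `[0, L], continuous (fun x => 2 * k * z * expR (- mu * x / 2))}.
  by move=> x; apply: cvgM; [exact: cvg_cst | exact: expR_continuous_within].
have iA : (@lebesgue_measure R).-integrable `[0, L] (EFin \o A).
  have -> : A = fun x => expR (- mu * x) * f x ^+ 2 + 2 * k * z * expR (- mu * x / 2) * f x.
    by apply/funext => x; rewrite /A; ring.
  apply: (integrableD _ (integrableM_continuous L0' cw sf.2)
    (integrableM_continuous L0' cwf (sq_integrable_integrable sf))) => //.
have i1 := integrableM_continuous L0' cw sf1.2.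
have i2 := integrableM_continuous L0' cw sf2.2.
have ic : (@lebesgue_measure R).-integrable `[0, L]
    (EFin \o fun=> r * k * lam / L * z ^+ 2).
  by apply: within_continuous_integrable => x; exact: cvg_cst.
have i1' : (@lebesgue_measure R).-integrable `[0, L]
    (EFin \o fun x => q3 * (expR (- mu * x) * f1 x ^+ 2)).
  exact: (integrableZl _ q3 i1).
have i2' : (@lebesgue_measure R).-integrable `[0, L]
    (EFin \o fun x => q4 * (expR (- mu * x) * f2 x ^+ 2)).
  exact: (integrableZl _ q4 i2).
have iAc : (@lebesgue_measure R).-integrable `[0, L]
    (EFin \o fun x => A x + r * k * lam / L * z ^+ 2).
  exact: (integrableD _ iA ic).
have iAc1 : (@lebesgue_measure R).-integrable `[0, L]
    (EFin \o fun x => A x + r * k * lam / L * z ^+ 2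
                      + q3 * (expR (- mu * x) * f1 x ^+ 2)).
  exact: (integrableD _ iAc i1').
have -> : dens = fun x => A x + r * k * lam / L * z ^+ 2
    + q3 * (expR (- mu * x) * f1 x ^+ 2) + q4 * (expR (- mu * x) * f2 x ^+ 2).
  by apply/funext => x; rewrite /dens /A /lyap_density -(expR_half_sqr (- mu * x)); ring.
split; first exact: (integrableD _ iAc1 i2').
rewrite RintegralD// RintegralD// RintegralD//.
rewrite Rintegral_cst_itv// RintegralZl// RintegralZl// /S_fun.
by congr (_ + _ + _ + _); field; rewrite gt_eqF.
Qed.

End S_fun_density.

Lemma S_fun_equiv_X_norm_sq (R : realType) (L mu r k q3 q4 : R) :
  let lam := expR (- mu * L / 2) in
  0 < L -> 0 < mu -> 0 < r -> 0 < k -> 0 < q3 -> 0 < q4 -> 2 * k * L < r * lam ->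
  exists K, 1 <= K /\ forall f f1 f2 z, H2 L f f1 f2 ->
    K^-1 * X_norm_sq L f f1 f2 z
      <= S_fun L mu (2 * k) (r * k * lam) q3 q4 f f1 f2 z
      <= K * X_norm_sq L f f1 f2 z.
Proof.
move=> lam L0 mu0 r0 k0 q30 q40 hk.
have lam0 : 0 < lam by exact: expR_gt0.
have lam1 : lam <= 1.
  by rewrite -expR0 ler_expR mulNr mulNr oppr_le0 divr_ge0// mulr_ge0// ltW.
have [m [M [m0 M0 mM]]] := lyap_density_coercive L0 r0 k0 lam0 q30 q40 hk.
(* The squared weight e^(- mu x) lies between lam^2 and 1 on [0, L]. The factors min(1, L) and
   max(1, L) come from comparing z^2 with z^2 / L, its share when it is spread over [0, L]. *)
pose c := m * lam ^+ 2 * Num.min 1 L.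
pose C := M * Num.max 1 L.
have min0 : 0 < Num.min 1 L by rewrite lt_min ltr01.
have c0 : 0 < c by rewrite !mulr_gt0.
pose K := Num.max 1 (Num.max c^-1 C).
have K1 : 1 <= K by rewrite /K le_max lexx.
have K0 : 0 < K by exact: lt_le_trans K1.
have Kc : K^-1 <= c.
  rewrite -[leRHS]invrK lef_pV2 ?posrE ?invr_gt0//.
  by rewrite /K !le_max lexx !orbT.
have KC : C <= K by rewrite /K !le_max lexx !orbT.
exists K; split=> // f f1 f2 z [/L2_fun_sq_integrable sf /L2_fun_sq_integrable sf1
  /L2_fun_sq_integrable sf2 _ _].
have [id ->] := S_fun_density mu r k lam q3 q4 z L0 sf sf1 sf2.
pose X x := f x ^+ 2 + f1 x ^+ 2 + f2 x ^+ 2 + z ^+ 2 / L.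
have ic : (@lebesgue_measure R).-integrable `[0, L] (EFin \o fun=> z ^+ 2 / L).
  by apply: within_continuous_integrable => x; exact: cvg_cst.
have iS : (@lebesgue_measure R).-integrable `[0, L]
    (EFin \o fun x => f x ^+ 2 + f1 x ^+ 2 + f2 x ^+ 2).
  have i12 : (@lebesgue_measure R).-integrable `[0, L]
      (EFin \o fun x => f x ^+ 2 + f1 x ^+ 2) by exact: (integrableD _ sf.2 sf1.2).
  exact: (integrableD _ i12 sf2.2).
have iX : (@lebesgue_measure R).-integrable `[0, L] (EFin \o X).
  exact: (integrableD _ iS ic).
have -> : X_norm_sq L f f1 f2 z = \int[@lebesgue_measure R]_(x in `[0, L]) X x.
  rewrite /X_norm_sq /X [RHS]RintegralD// Rintegral_cst_itv// divfK ?gt_eqF//.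
  by congr (_ + _); apply: eq_Rintegral => x _; rewrite !real_normK ?num_real.
rewrite -!RintegralZl//.
have bound x : `[0, L]%classic x ->
    K^-1 * X x <= lyap_density L r k lam q3 q4 (expR (- mu * x / 2) * f x)
      (expR (- mu * x / 2) * f1 x) (expR (- mu * x / 2) * f2 x) z <= K * X x.
  rewrite /= in_itv/= => /andP[x0 xL].
  set e := expR (- mu * x / 2).
  have e0 : 0 < e by exact: expR_gt0.
  have e1 : e ^+ 2 <= 1.
    rewrite expr_le1//; last exact: ltW.
    by rewrite -expR0 ler_expR mulNr mulNr oppr_le0 divr_ge0// mulr_ge0// ltW.
  have el : lam ^+ 2 <= e ^+ 2.
    rewrite lerXn2r ?nnegrE ?(ltW lam0) ?(ltW e0)// ler_expR.
    by rewrite ler_pM2r ?invr_gt0// ler_nM2l// oppr_lt0.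
  have l1 : lam ^+ 2 <= 1 by exact: le_trans el e1.
  pose s := f x ^+ 2 + f1 x ^+ 2 + f2 x ^+ 2.
  have s0 : 0 <= s by rewrite !addr_ge0 ?sqr_ge0.
  have z0 := sqr_ge0 z.
  have zL0 : 0 <= z ^+ 2 / L by rewrite divr_ge0// ltW.
  have X0 : 0 <= X x by exact: addr_ge0.
  have zE : z ^+ 2 = L * (z ^+ 2 / L) by rewrite mulrC divfK// gt_eqF.
  have := mM (e * f x) (e * f1 x) (e * f2 x) z.
  have -> : (e * f x) ^+ 2 + (e * f1 x) ^+ 2 + (e * f2 x) ^+ 2 + z ^+ 2 =
    e ^+ 2 * s + z ^+ 2 by rewrite /s; ring.
  move=> /andP[h1 h2]; apply/andP; split.
    apply: le_trans h1; apply: le_trans (ler_wpM2r X0 Kc) _.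
    rewrite /c -!(mulrA m); apply: ler_wpM2l; first exact: ltW.
    apply: (@le_trans _ _ (lam ^+ 2 * (s + z ^+ 2))).
      rewrite -mulrA; apply: ler_wpM2l; first exact: sqr_ge0.
      rewrite /X -/s mulrDr lerD//.
        by rewrite ler_piMl// ge_min lexx.
      by rewrite [leRHS]zE ler_wpM2r// ge_min lexx orbT.
    by rewrite mulrDr lerD// ?ler_wpM2r// ler_piMl.
  apply: le_trans h2 _; apply: le_trans (ler_wpM2r X0 KC).
  rewrite /C -(mulrA M); apply: ler_wpM2l; first exact: ltW.
  rewrite /X -/s [leRHS]mulrDr lerD//.
    by rewrite ler_wpM2r// (le_trans e1)// le_max lexx.
  by rewrite [leLHS]zE ler_wpM2r// le_max lexx orbT.
apply/andP; split; apply: le_Rintegral => //.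
- exact: (integrableZl _ K^-1 iX).
- by move=> x /bound/andP[].
- exact: (integrableZl _ K iX).
- by move=> x /bound/andP[].
Qed.

(** * Decay along the closed loop *)

(** The suprema over phi and phi_x are genuine only because [C0T_Ck_bounded] bounds the sets; the
    default value 0 of an unbounded [sup] would give no pointwise information. *)
Lemma Tinf_norm_lt (R : realType) (T L delta : R) k phi xi : 0 < L ->
  (0 < k)%N -> C0T_Ck T L k phi -> Tinf_norm T L phi xi < delta ->
  forall t x, t \in `[0, T] -> x \in `[0, L] ->
    `|phi t x| < delta /\ `|dx L phi t x| < delta.
Proof.
move=> L0 k0 Cphi hd t x tT xL.
have [M0 h0] := C0T_Ck_bounded L0 Cphi (leq0n k).
have [M1 h1] := C0T_Ck_bounded L0 Cphi k0.
have i0 := sup_norm_image_ge0 (`[0, T]%classic : set R) xi.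
have i1 := sup_norm_image_ge0 (`[0, T] `*` `[0, L]) (fun tx => phi tx.1 tx.2).
have i2 := sup_norm_image_ge0 (`[0, T] `*` `[0, L]) (fun tx => dx L phi tx.1 tx.2).
have s1 : `|phi t x| <= sup [set `|phi tx.1 tx.2| | tx in `[0, T] `*` `[0, L]].
  apply: ub_le_sup; last by exists (t, x).
  by exists M0 => _ [[t' x'] [/= t'T x'L] <-]; exact: h0.
have s2 : `|dx L phi t x| <= sup [set `|dx L phi tx.1 tx.2| | tx in `[0, T] `*` `[0, L]].
  apply: ub_le_sup; last by exists (t, x).
  by exists M1 => _ [[t' x'] [/= t'T x'L] <-]; exact: h1.
by move: hd; rewrite /Tinf_norm => hd; split; lra.
Qed.

Lemma norm_le_normD (R : realDomainType) (x y d : R) :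
  `|x - y| <= d -> `|y| <= `|x| + d.
Proof.
move=> h; rewrite -{1}(subKr x y) addrC.
by apply: le_trans (ler_normD _ _) _; rewrite normrN addrC lerD2l.
Qed.

Lemma C2_fun_small (R : realType) (F : R -> R) (eta : R) : C2_fun F -> 0 < eta ->
  exists delta, 0 < delta /\ forall a b, `|a| < delta -> `|b| < delta ->
    [/\ `|F a - F 0| <= eta, `|derive1 F a * b| <= eta
      & `|derive1n 2 F a * b ^+ 2| <= eta].
Proof.
move=> [dF dF' cF''] eta0.
have cF : {for 0, continuous F}.
  by apply: differentiable_continuous; exact/derivable1_diffP.
have cF' : {for 0, continuous (derive1 F)}.
  by apply: differentiable_continuous; exact/derivable1_diffP.
have [d /= d0 hd] : \forall a \near (0 : R), [/\ `|F 0 - F a| <= eta,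
    `|derive1 F 0 - derive1 F a| <= 1 & `|derive1n 2 F 0 - derive1n 2 F a| <= 1].
  near=> a; split; near: a.
  - by move/cvgrPdist_le : cF; exact.
  - by move/cvgrPdist_le : cF'; exact.
  - by have /cvgrPdist_le := cF'' 0; exact.
pose M := `|derive1 F 0| + `|derive1n 2 F 0| + 1.
have M0 : 0 < M by rewrite /M ltr_wpDl// addr_ge0.
(* M bounds F' and F'' within distance d of 0; |b| < 1 gives b^2 <= |b|, so |b| < eta / M handles
   both products. *)
exists (Num.min d (Num.min 1 (eta / M))).
split; first by rewrite !lt_min d0 ltr01 divr_gt0.
move=> a b; rewrite !lt_min => /and3P[ad _ _] /and3P[_ b1 bM].
have [|h0 h1 h2] := hd a; first by rewrite /ball/= sub0r normrN.
have M1 : `|derive1 F a| <= M.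
  by apply: le_trans (norm_le_normD h1) _; rewrite lerD2r lerDl.
have M2 : `|derive1n 2 F a| <= M.
  by apply: le_trans (norm_le_normD h2) _; rewrite lerD2r lerDr.
have bME : M * `|b| <= eta by rewrite mulrC -ler_pdivlMr// ltW.
split; first by rewrite distrC.
  by rewrite normrM (le_trans _ bME)// ler_wpM2r.
rewrite normrM normrX (le_trans _ bME)// ler_pM// ?exprn_ge0//.
by rewrite expr2 ler_piMl// ltW.
Unshelve. all: by end_near. Qed.

(** * C^1 functions of x and the balance of the flux *)

(* The derivative of [f] is only required to be [g] in the open interval,
   which is what the fundamental theorem of calculus asks for. *)
Definition C1_on (R : realType) (L : R) (f g : R -> R) : Prop :=
  [/\ {within `[0, L], continuous f}, {within `[0, L], continuous g}
    & forall x, x \in `]0, L[ -> is_derive x 1 f (g x)].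

Lemma C1_on_cst (R : realType) (L c : R) : C1_on L (cst c) (cst 0).
Proof. by split=> [x|x|x _]; [exact: cvg_cst | exact: cvg_cst | exact: is_derive_cst]. Qed.

Lemma C1_onD (R : realType) (L : R) (f f' g g' : R -> R) :
  C1_on L f f' -> C1_on L g g' ->
  C1_on L (fun x => f x + g x) (fun x => f' x + g' x).
Proof.
move=> [cf cf' df] [cg cg' dg]; split=> x.
- by apply: cvgD; [exact: cf | exact: cg].
- by apply: cvgD; [exact: cf' | exact: cg'].
- by move=> xL; apply: is_deriveD; [exact: df | exact: dg].
Qed.

Lemma C1_onM (R : realType) (L : R) (f f' g g' : R -> R) :
  C1_on L f f' -> C1_on L g g' ->
  C1_on L (fun x => f x * g x) (fun x => f x * g' x + g x * f' x).
Proof.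
move=> [cf cf' df] [cg cg' dg]; split=> x.
- by apply: cvgM; [exact: cf | exact: cg].
- by apply: cvgD; apply: cvgM; [exact: cf | exact: cg' | exact: cg | exact: cf'].
- by move=> xL; apply: is_deriveM; [exact: df | exact: dg].
Qed.

Lemma within_continuous_compose (R : realType) (A : set R) (G f : R -> R) :
  continuous G -> {within A, continuous f} -> {within A, continuous (G \o f)}.
Proof. by move=> cG cf x; apply: (cvg_comp _ _ (cf x)); exact: cG. Qed.

Lemma C1_on_comp (R : realType) (L : R) (F f f' : R -> R) :
  (forall y, derivable F y 1) -> continuous (derive1 F) -> C1_on L f f' ->
  C1_on L (F \o f) (fun x => derive1 F (f x) * f' x).
Proof.
move=> dF cF' [cf cf' df]; split=> x.
- apply: within_continuous_compose cf _ => y.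
  by apply: differentiable_continuous; exact/derivable1_diffP.
- by apply: cvgM; [exact: (within_continuous_compose cF' cf) | exact: cf'].
move=> xL; apply: is_derive1_comp; last exact: df.
by apply: DeriveDef => //; rewrite derive1E.
Qed.

Lemma C1_on_expR (R : realType) (L c d : R) :
  C1_on L (fun x => expR (c * x / d)) (fun x => c / d * expR (c * x / d)).
Proof.
have ce : {within `[0, L], continuous (fun x => expR (c * x / d))}.
  exact: expR_continuous_within.
split=> [//|x|x _]; first by apply: cvgM; [exact: cvg_cst | exact: ce].
have dg : is_derive x 1 (fun x => c * x / d) (c / d).
  have -> : (fun x => c * x / d) = (c / d) \*: id.
    by apply/funext => y /=; rewrite mulrAC.
  by rewrite -[X in is_derive _ _ _ X](mulr1 (c / d)); exact: is_deriveZ.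
rewrite mulrC; exact: is_derive1_comp (is_derive_expR _) dg.
Qed.

Lemma Ck_in_C1_on (R : realType) (L : R) k i (f : R -> R) :
  Ck_in 0 L k f -> (i < k)%N ->
  C1_on L (deriven_in 0 L i f) (deriven_in 0 L i.+1 f).
Proof.
move=> [df cf] ik; split=> [||x xL]; [exact/cf/ltnW | exact: cf |].
apply: (has_deriv_in_is_derive xL); apply: derivable_in_has_deriv.
by apply: df => //; exact: subset_itv_oo_cc xL.
Qed.

(** The left side is the time derivative of the density with phi_t, s_t and p_t eliminated by (N),
    (N1), (N2). B is the x-derivative of the flux, as the product and chain rules produce it. It
    adds F'(phi) phi_x to each square, which turns the coefficients 0, -2, -6 coming from the
    equations into the 1, -1, -5 of [lyap_rate]. *)
Lemma flux_balance (R : realType) (L mu r k lam q3 q4 : R) (F u s p p' : R -> R)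
    (xi y : R) :
  let e x := expR (- mu * x / 2) in
  0 < L -> C2_fun F -> C1_on L u s -> C1_on L s p -> C1_on L p p' ->
  exists B, C1_on L (fun x => flux k q3 q4 (F (u x)) (e x) (u x) (s x) (p x) xi) B /\
    forall x, 2 * (e x * u x) * (e x * - (F (u x) * s x))
      + 2 * k * (y * (e x * u x) + xi * (e x * - (F (u x) * s x)))
      + 2 * (r * k * lam / L) * xi * y
      + q3 * (2 * (e x * s x)
              * (e x * (- derive1 F (u x) * s x ^+ 2 - F (u x) * p x)))
      + q4 * (2 * (e x * p x)
              * (e x * (- 3 * derive1 F (u x) * s x * p x
                        - derive1n 2 F (u x) * s x ^+ 3 - F (u x) * p' x)))
    = lyap_rate L r k mu lam q3 q4 (e x * u x) (e x * s x) (e x * p x) xi y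
        (F (u x)) (derive1 F (u x) * s x) (derive1n 2 F (u x) * s x ^+ 2) - B x.
Proof.
move=> e L0 [dF dF' _] Hu Hs Hp.
have cF' : continuous (derive1 F).
  by move=> z; apply: differentiable_continuous; exact/derivable1_diffP.
have He : C1_on L e _ := C1_on_expR L (- mu) 2.
have HF := C1_on_comp dF cF' Hu.
have HeF := C1_onM (C1_onM He He) HF.
have H := C1_onD (C1_onD (C1_onD (C1_onM HeF (C1_onM Hu Hu))
    (C1_onM (C1_onM (C1_onM (C1_on_cst L (2 * k * xi)) He) HF) Hu))
    (C1_onM (C1_on_cst L q3) (C1_onM HeF (C1_onM Hs Hs))))
    (C1_onM (C1_on_cst L q4) (C1_onM HeF (C1_onM Hp Hp))).
eexists; split; first exact: H.
move=> x; rewrite /lyap_rate /cst /= -/(e x).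
move: (e x) (F (u x)) (derive1 F (u x)) (derive1n 2 F (u x)) => w a b c.
by move: (r * k * lam / L) => d; field.
Qed.

(** D is assembled by the sum and product rules of [unif_deriv]; its explicit value has the shape of
    the left side in [flux_balance]. *)
Lemma lyap_density_unif_deriv (R : realType) (T L mu r k lam q3 q4 : R)
    (u s p : R -> R -> R) (u' s' p' : R -> R) (xi : R -> R) (y t0 : R) :
  let e x := expR (- mu * x / 2) in
  0 <= L -> t0 \in `[0, T] ->
  unif_deriv T L u u' t0 -> unif_deriv T L s s' t0 -> unif_deriv T L p p' t0 ->
  has_deriv_in 0 T xi t0 y ->
  exists D, unif_deriv T L (fun t x =>
      lyap_density L r k lam q3 q4 (e x * u t x) (e x * s t x) (e x * p t x) (xi t)) D t0
    /\ forall x, D x = 2 * (e x * u t0 x) * (e x * u' x)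
      + 2 * k * (y * (e x * u t0 x) + xi t0 * (e x * u' x))
      + 2 * (r * k * lam / L) * xi t0 * y
      + q3 * (2 * (e x * s t0 x) * (e x * s' x))
      + q4 * (2 * (e x * p t0 x) * (e x * p' x)).
Proof.
move=> e L0 t0T Hu Hs Hp /(unif_deriv_time L) Hxi.
have He : unif_deriv T L (fun=> e) (cst 0) t0.
  by apply: unif_deriv_cst; exact: expR_continuous_within.
have Hc c : unif_deriv T L (fun=> cst c) (cst 0) t0.
  by apply: unif_deriv_cst => x; exact: cvg_cst.
pose M h k v w := @unif_derivM R T L h k v w t0 L0 t0T.
have Hu' := M _ _ _ _ He Hu.
have Hs' := M _ _ _ _ He Hs.
have Hp' := M _ _ _ _ He Hp.
have H := unif_derivD (unif_derivD (unif_derivD (unif_derivD (M _ _ _ _ Hu' Hu')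
    (M _ _ _ _ (M _ _ _ _ (Hc (2 * k)) Hxi) Hu'))
    (M _ _ _ _ (Hc (r * k * lam / L)) (M _ _ _ _ Hxi Hxi)))
    (M _ _ _ _ (Hc q3) (M _ _ _ _ Hs' Hs')))
    (M _ _ _ _ (Hc q4) (M _ _ _ _ Hp' Hp')).
eexists; split; first exact: H.
by move=> x; rewrite /cst /=; move: (r * k * lam / L) => d; ring.
Qed.

Lemma closed_loop_decay (R : realType) (T L mu k q3 q4 eta beta delta : R)
    (F : R -> R) (phi : R -> R -> R) (xi phi0 : R -> R) (xi0 : R) :
  let r := F 0 in let lam := expR (- mu * L / 2) in
  0 < L -> 0 < T -> C2_fun F ->
  (forall a b, `|a| < delta -> `|b| < delta ->
    [/\ `|F a - r| <= eta, `|derive1 F a * b| <= eta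
      & `|derive1n 2 F a * b ^+ 2| <= eta]) ->
  (forall a b c xi y sL pL s0 p0 Fx FL F0 h1 h2 d,
    `|Fx - r| <= eta -> `|FL - r| <= eta -> `|F0 - r| <= eta ->
    `|h1| <= eta -> `|h2| <= eta -> `|d * s0| <= eta ->
    F0 * s0 = k * y -> F0 ^+ 2 * p0 = k * FL * sL - 2 * k * d * y * s0 ->
    lyap_rate L r k mu lam q3 q4 a b c xi y Fx h1 h2
    - (flux k q3 q4 FL lam y sL pL xi - flux k q3 q4 F0 1 (- k * xi) s0 p0 xi) / L
    <= - beta * lyap_density L r k lam q3 q4 a b c xi) ->
  C0T_Ck T L 3 phi -> C1T_Ck T L 2 phi -> Ck_in 0 T 1 xi ->
  closed_loop T L F k phi0 xi0 phi xi -> Tinf_norm T L phi xi < delta ->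
  let V t := S_fun L mu (2 * k) (r * k * lam) q3 q4
    (phi t) (dx L phi t) (dx L (dx L phi) t) (xi t) in
  forall t, t \in `[0, T] ->
    derivable_in 0 T V t /\ derive_in 0 T V t <= - beta * V t.
Proof.
move=> r lam L0 T0 C2F small diss C3 [C2 [v [Cv dv]]] Cxi
  [[N1 Nxi N0 _ _] [S1 S0 _] [P1 P0 _]] hdelta V t tT.
have bnd := Tinf_norm_lt L0 (isT : (0 < 3)%N) C3 hdelta.
have xL : L \in `[0, L] by rewrite in_itv/= lexx ltW.
have x0 : 0 \in `[0, L] by rewrite in_itv/= lexx ltW.
pose e x := expR (- mu * x / 2).
have Hxi : has_deriv_in 0 T xi t (phi t L).
  by rewrite -Nxi//; apply/derivable_in_has_deriv/(Cxi.1 0%N).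
have UD := unif_deriv_deriven L0 tT C2 Cv (dv t tT).
have U0 := UD 0%N isT; have U1 := UD 1%N isT; have U2 := UD 2%N isT.
have [D [HD DE]] := lyap_density_unif_deriv mu r k lam q3 q4 (ltW L0) tT U0 U1 U2 Hxi.
have [D1 D2 D3] := And3 (Ck_in_C1_on (C3.1 t tT) (isT : (0 < 3)%N))
  (Ck_in_C1_on (C3.1 t tT) (isT : (1 < 3)%N)) (Ck_in_C1_on (C3.1 t tT) (isT : (2 < 3)%N)).
have [B [HB BE]] := flux_balance mu r k lam q3 q4 (xi t) (phi t L) L0 C2F D1 D2 D3.
have dens_int tau : tau \in `[0, T] -> _ := fun tauT =>
  S_fun_density mu r k lam q3 q4 (xi tau) L0
    (continuous_sq_integrable ((C3.1 tau tauT).2 0%N isT))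
    (continuous_sq_integrable ((C3.1 tau tauT).2 1%N isT))
    (continuous_sq_integrable ((C3.1 tau tauT).2 2%N isT)).
have HV : has_deriv_in 0 T V t (\int[@lebesgue_measure R]_(x in `[0, L]) D x).
  apply: has_deriv_in_eq tT _ (unif_deriv_integral L0 tT HD).
  by move=> tau tauT; rewrite /V (dens_int tau tauT).2.
split; first by apply/cvg_ex; eexists; exact: HV.
rewrite (derive_inE T0 tT HV) /V (dens_int t tT).2.
have [_ cD _] := HD; have iD := within_continuous_integrable cD.
have [cflux cB dB] := HB; have iB := within_continuous_integrable cB.
have idens := (dens_int t tT).1.
have iV : (@lebesgue_measure R).-integrable `[0, L] (EFin \o fun x => - beta *
    lyap_density L r k lam q3 q4 (e x * phi t x) (e x * dx L phi t x)
      (e x * dx L (dx L phi) t x) (xi t)) by exact: (integrableZl _ (- beta) idens).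
set J := (X in _ <= - beta * X).
pose fl x := flux k q3 q4 (F (phi t x)) (e x) (phi t x) (dx L phi t x)
  (dx L (dx L phi) t x) (xi t).
have JB : \int[@lebesgue_measure R]_(x in `[0, L]) B x = fl L - fl 0.
  exact: Rintegral_is_derive.
have ic : (@lebesgue_measure R).-integrable `[0, L] (EFin \o fun=> (fl L - fl 0) / L).
  by apply: within_continuous_integrable => x; exact: cvg_cst.
have iBc : (@lebesgue_measure R).-integrable `[0, L]
    (EFin \o fun x => (fl L - fl 0) / L - B x) by exact: (integrableB _ ic iB).
(* The added term (fl L - fl 0) / L - B has integral zero, so the two integrals can be compared
   through their integrands. *)
have -> : - beta * J = \int[@lebesgue_measure R]_(x in `[0, L])
    (- beta * lyap_density L r k lam q3 q4 (e x * phi t x) (e x * dx L phi t x)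
       (e x * dx L (dx L phi) t x) (xi t) + ((fl L - fl 0) / L - B x)).
  rewrite RintegralD// RintegralB// JB Rintegral_cst_itv// RintegralZl//.
  by rewrite divfK ?gt_eqF// subrr addr0.
apply: le_Rintegral => //; first exact: (integrableD _ iV iBc).
move=> x xL'; have xin : x \in `[0, L] by [].
(* Uniqueness of limits identifies the pointwise time derivatives in the system with v and its
   x-derivatives; the equations then give their values. *)
have E0 : deriven_in 0 L 0 (v t) x = - (F (phi t x) * dx L phi t x).
  have := N1 t x tT xin; rewrite /dt (derive_inE T0 tT (unif_deriv_pointwise xin U0)).
  by move/eqP; rewrite addr_eq0 => /eqP.
have E1 : deriven_in 0 L 1 (v t) x = - derive1 F (phi t x) * dx L phi t x ^+ 2
    - F (phi t x) * dx L (dx L phi) t x.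
  have := S1 t x tT xin; rewrite /dt (derive_inE T0 tT (unif_deriv_pointwise xin U1)).
  by move=> <-; rewrite addrK.
have E2 : deriven_in 0 L 2 (v t) x =
    - 3 * derive1 F (phi t x) * dx L phi t x * dx L (dx L phi) t x
    - derive1n 2 F (phi t x) * dx L phi t x ^+ 3
    - F (phi t x) * dx L (dx L (dx L phi)) t x.
  have := P1 t x tT xin; rewrite /dt (derive_inE T0 tT (unif_deriv_pointwise xin U2)).
  by move=> <-; rewrite addrK.
have [ux sx] := bnd t x tT xin; have [uL sL] := bnd t L tT xL.
have [u0 s0] := bnd t 0 tT x0.
have [Fx hx1 hx2] := small _ _ ux sx; have [FL _ _] := small _ _ uL sL.
have [F0 h0 _] := small _ _ u0 s0.
have := diss (e x * phi t x) (e x * dx L phi t x) (e x * dx L (dx L phi) t x) (xi t)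
  (phi t L) (dx L phi t L) (dx L (dx L phi) t L) _ _ _ _ _ _ _ _ Fx FL F0 hx1 hx2 h0
  (S0 t tT) (P0 t tT).
(* At x = 0 the weight is 1 and the feedback law gives phi(0,t) = - k xi. *)
have -> : flux k q3 q4 (F (phi t 0)) 1 (- k * xi t) (dx L phi t 0)
    (dx L (dx L phi) t 0) (xi t) = fl 0.
  by rewrite /fl /e -(N0 t tT) mulr0 mul0r expR0.
rewrite DE E0 E1 E2 (BE x) addrA lerD2r lerBlDr; exact.
Qed.

(** The first bound, the gain condition squared, feeds the dissipation estimate. The second follows
    from z (2 - z) = 1 - (z - 1)^2 <= 1 and makes S coercive. *)
Lemma Pi_fun_gain_bounds (R : realType) (L mu r k : R) :
  let lam := expR (- mu * L / 2) in
  0 < L -> 0 < r -> 0 < k -> 0 <= mu * L <= 2 ->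
  k < r / (2 * L) * Pi_fun (mu * L) ->
  k ^+ 2 < (r / (2 * L)) ^+ 2 * (mu * L * (2 - mu * L)) * lam ^+ 2 /\
  2 * k * L < r * lam.
Proof.
move=> lam L0 r0 k0 /andP[z0 z2].
have -> : Pi_fun (mu * L) = Num.sqrt (mu * L * (2 - mu * L)) * lam.
  by rewrite /Pi_fun /lam !mulNr.
have lam0 : 0 < lam by exact: expR_gt0.
have w0 : 0 <= mu * L * (2 - mu * L) by rewrite mulr_ge0// subr_ge0.
have rL : 0 < r / (2 * L) by rewrite divr_gt0// mulr_gt0.
move=> hk; split.
  rewrite -(sqr_sqrtr w0) -!exprMn ltr_pXn2r// ?nnegrE ?(ltW k0)//.
    by rewrite -mulrA.
  by rewrite !mulr_ge0 ?sqrtr_ge0 ?invr_ge0 ?ltW// mulr_gt0.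
have w1 : Num.sqrt (mu * L * (2 - mu * L)) <= 1.
  rewrite -[leRHS]sqrtr1; apply: ler_wsqrtr; rewrite -subr_ge0.
  have -> : 1 - mu * L * (2 - mu * L) = (mu * L - 1) ^+ 2 by ring.
  exact: sqr_ge0.
have : k < r / (2 * L) * lam.
  apply: lt_le_trans hk _; rewrite ler_wpM2l//; first exact: ltW.
  by rewrite ler_piMl// ltW.
rewrite mulrAC ltr_pdivlMr ?mulr_gt0//; congr (_ < _); ring.
Qed.

Unset Implicit Arguments.

Theorem theorem2 (R : realType) (L T : R) (F : R -> R) (r kI mu q1 q2 : R)
    (hL : 0 < L) (hT : 0 < T)
    (hF : C2_fun F) (hFpos : forall sigma, 0 < F sigma) (hr : r = F 0)
    (hkI : 0 < kI < kI_star L r)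
    (hmu : 0 < mu <= (2 - Num.sqrt 2) / L)
    (hmukI : kI < r / (2 * L) * Pi_fun (mu * L))
    (hq1 : q1 = 2 * kI) (hq2 : q2 = r * kI * expR (- mu * L / 2)) :
  exists q3 q4 delta beta : R,
    [/\ 0 < q3, 0 < q4, 0 < delta & 0 < beta] /\
    (forall (phi : R -> R -> R) (xi : R -> R) (phi0 : R -> R) (xi0 : R),
       C0T_Ck T L 3 phi -> C1T_Ck T L 2 phi -> Ck_in 0 T 1 xi ->
       closed_loop T L F kI phi0 xi0 phi xi ->
       Tinf_norm T L phi xi < delta ->
       let V := fun t => S_fun L mu q1 q2 q3 q4
                  (phi t) (dx L phi t) (dx L (dx L phi) t) (xi t) in
       forall t : R, t \in `[0, T] ->
         derivable_in 0 T V t /\ derive_in 0 T V t <= - beta * V t) /\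
    (exists K : R, 1 <= K /\
       forall (f f1 f2 : R -> R) (z : R), H2 L f f1 f2 ->
         K^-1 * X_norm_sq L f f1 f2 z <= S_fun L mu q1 q2 q3 q4 f f1 f2 z
         <= K * X_norm_sq L f f1 f2 z).
Proof.
have r0 : 0 < r by rewrite hr.
have k0 : 0 < kI by case/andP: hkI.
(* The bound mu L <= 2 - sqrt 2 <= 2 keeps the radicand of [Pi_fun] nonnegative. *)
have [mu0 muL] : 0 < mu /\ mu * L <= 2.
  move: hmu => /andP[-> h]; split=> //; move: h; rewrite ler_pdivlMr// => h.
  by apply: le_trans h _; rewrite lerBlDr lerDl sqrtr_ge0.
have lam0 : 0 < expR (- mu * L / 2) by exact: expR_gt0.
have [|hk hk'] := Pi_fun_gain_bounds hL r0 k0 _ hmukI.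
  by rewrite muL mulr_ge0 ?ltW.
have [q3 [q4 [eta [beta [[q30 q40 eta0 beta0] diss]]]]] :=
  dissipation hL r0 k0 mu0 lam0 hk.
have [delta [delta0 small]] := C2_fun_small hF eta0.
exists q3, q4, delta, beta; split=> //; subst q1 q2 r; split.
  move=> phi xi phi0 xi0 C3 C12 Cxi sys hd.
  exact: closed_loop_decay hL hT hF small diss C3 C12 Cxi sys hd.
exact: S_fun_equiv_X_norm_sq.
Qed.
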